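(* Let $m,c_1,\ldots,c_m,r,b\in\mathbb{N}$, $a\in\mathbb{N}_0$, $C=\sum_{j=1}^mc_j$, and suppose $a-c_m\le b-C\le a$. Then there is a constant $M(\overline{c})<C^{m-1}$, depending only on $c_1,\ldots,c_m$, such that for every $n\in\mathbb{N}$ \[ \left|\gamma-\frac{(c_1n)!\cdots(c_mn)!}{(Cn)!\,(-r)^{Cn}}\sum_{k=0}^{Cn}(-1)^k\binom{Cn}{k}\prod_{j=1}^m\binom{rk+(a+c_1+\cdots+c_j)n+j}{c_jn}S_{rk+bn+m}\right| \] \[ <M(\overline{c})\left(\frac{b^{b/r}C^C(C+a-b)^{C+a-b}(c_m+b-a-C)^{c_m+b-a-C}}{c_m^{c_m}(b+Cr)^{C+b/r}}\right)^n . \]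
   Context: $\gamma$ is Euler's constant; $S_n=\sum_{k=1}^n\frac1k-\log(n+1)$. The convention $0^0=1$ is used. *)

(* Defs.v *)
From HB Require Import structures.
From mathcomp Require Import all_boot all_order all_algebra.
From mathcomp Require Import all_classical all_reals all_analysis.

Set Implicit Arguments.
Unset Strict Implicit.
Unset Printing Implicit Defensive.

Import Order.TTheory GRing.Theory Num.Theory.
Import numFieldNormedType.Exports.

Local Open Scope ring_scope.

(* [harmonic k] is [1 / (k + 1)], so [series harmonic n] is [1 + 1/2 + ... + 1/n]. *)
Definition euler_gamma (R : realType) : R :=
  limn (fun n : nat => series (@harmonic R) n - ln n%:R).

Definition euler_S (R : realType) (n : nat) : R :=
  series (@harmonic R) n - ln n.+1%:R.

(* Main.v *)
Require Import Defs.
From HB Require Import structures.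
From mathcomp Require Import all_boot all_order all_algebra.
From mathcomp Require Import all_classical all_reals all_analysis.
From mathcomp Require Import measurable_realfun ring lra zify.
Import Order.TTheory GRing.Theory Num.Theory.
Import numFieldNormedType.Exports.
Local Open Scope ring_scope.

(** For [0 < t < 1] the power [x^(t-1)] is a Stieltjes transform, proportional to
    the integral of [s^(t-1) / (s + x)] over [s > 0].  Consequently [gamma - S_k]
    is a limit of means over [t] of integrals over [s] of the moments
    [int_0^1 x^k / (s + x) dx], against measures for which [1 / s] has mass [1].
    It is therefore enough to bound the alternating sum by [D / s] when
    [gamma - S_k] is replaced by such a moment with [s] fixed.
    The binomials form a product of [C n] linear factors in [r k].  Each factor is
    moved into the integrand by an integration by parts whose boundary term is a
    polynomial of degree less than [C n] in [k], which the alternating sum kills.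
    With [u = x / (s + x)] and [v = 1 - u], the factors of the last binomial lead
    to a power of [u]; the other ones produce a polynomial with nonnegative
    coefficients, dominated by a multiple of [(u + v)^S].  What is left is
    [x^(bn) (1 - x^r)^(Cn) (u^p v^q)^n] with [p = C + a - b] and
    [q = c_m + b - a - C], bounded by the weighted AM-GM inequality, while the
    ratio of the factorials is at most [C^(m-1)] and integrating [x] gives [1/2]. *)

Set Implicit Arguments.
Unset Strict Implicit.
Unset Printing Implicit Defensive.

(** * Stieltjes measures *)

Section kernel.
Local Open Scope classical_set_scope.
Context {R : realType}.
Notation mu := (@lebesgue_measure R).

Implicit Types t x w : R.

(* The Stieltjes kernel in the variable [w = ln s]: [s^t / (s + x)], with [ds / s = dw]. *)
Definition sker (t x w : R) : R := expR (t * w) / (expR w + x).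

Lemma sker_ge0 t x w : 0 <= x -> 0 <= sker t x w.
Proof. by move=> x0; rewrite divr_ge0 ?expR_ge0// addr_ge0// expR_ge0. Qed.

Lemma continuous_expRM (t : R) : continuous (fun w : R => expR (t * w)).
Proof.
move=> w; apply: continuous_comp; last exact: continuous_expR.
by apply: continuousM; [exact: cst_continuous|exact: cvg_id].
Qed.

Lemma continuous_sker t x : 0 <= x -> continuous (sker t x).
Proof.
move=> x0 w; rewrite /sker.
apply: (@continuousM _ _ (fun w => expR (t * w)) (fun w => (expR w + x)^-1)).
  exact: continuous_expRM.
apply: continuousV; first by rewrite gt_eqF// ltr_wpDr// expR_gt0.
by apply: continuousD; [exact: continuous_expR|exact: cst_continuous].
Qed.

(** Keep only the dominant term of the denominator: [expR w] for [w >= 0], leaving the rate [1 - t],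
    and [1] for [w < 0], leaving the rate [t]. *)
Lemma sker_le_abs t w : 0 < t < 1 ->
  sker t 1 w <= expR (- Num.min t (1 - t) * `|w|).
Proof.
move=> /andP[t0 t1]; rewrite /sker ler_pdivrMr ?addr_gt0 ?expR_gt0//.
rewrite mulrDr mulr1 -expRD.
have [w0|w0] := leP 0 w.
  rewrite ger0_norm//; apply: ler_wpDr; first exact: expR_ge0.
  rewrite ler_expR.
  have : Num.min t (1 - t) * w <= (1 - t) * w by rewrite ler_wpM2r// ge_min lexx orbT.
  lra.
rewrite ltr0_norm//; apply: ler_wpDl; first exact: expR_ge0.
rewrite ler_expR mulrNN.
by rewrite ler_wnM2r ?(ltW w0)// ge_min lexx.
Qed.

Lemma integral_expR_abs_lty (a : R) : 0 < a ->
  (\int[mu]_w (expR (- a * `|w|))%:E < +oo)%E.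
Proof.
move=> a0; rewrite ge0_symfun_integralT; last 3 first.
- by move=> x; exact: expR_ge0.
- move=> w; apply: continuous_comp; last exact: continuous_expR.
  by apply: continuousM; [exact: cst_continuous|exact: norm_continuous].
- by move=> x /=; rewrite normrN.
rewrite -set_itvcy lte_mul_pinfty//.
rewrite (_ : (\int[mu]_(x in `[0%R, +oo[) (expR (- a * `|x|))%:E)%E =
   (\int[mu]_(x in `[0%R, +oo[) ((a^-1)%:E * (exponential_pdf a x)%:E))%E); last first.
  apply: eq_integral => x; rewrite inE/= in_itv/= andbT => x0.
  by rewrite exponential_pdfE// ger0_norm// -EFinM mulrA mulVf ?gt_eqF// mul1r.
rewrite ge0_integralZl//; last 3 first.
- by apply/measurable_EFinP; apply: measurable_funTS; exact: measurable_exponential_pdf.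
- by move=> x _; rewrite lee_fin exponential_pdf_ge0// ltW.
- by rewrite lee_fin invr_ge0 ltW.
rewrite lte_mul_pinfty ?lee_fin ?invr_ge0 ?ltW//.
apply: (@le_lt_trans _ _ 1%E); last exact: ltry.
rewrite -(integral_exponential_pdf a0).
apply: ge0_subset_integral => //.
- by apply/measurable_EFinP; exact: measurable_exponential_pdf.
- by move=> x _; rewrite lee_fin exponential_pdf_ge0// ltW.
Qed.

Lemma sker_lty t : 0 < t < 1 -> (\int[mu]_w (sker t 1 w)%:E < +oo)%E.
Proof.
move=> t01; have a0 : 0 < Num.min t (1 - t).
  by case/andP: t01 => t0 t1; rewrite lt_min t0 subr_gt0.
apply: le_lt_trans (integral_expR_abs_lty a0).
apply: ge0_le_integral => //.
- by move=> x _; rewrite lee_fin sker_ge0.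
- by apply/measurable_EFinP; apply: continuous_measurable_fun; exact: continuous_sker.
- apply/measurable_EFinP; apply: continuous_measurable_fun.
  move=> w; apply: continuous_comp; last exact: continuous_expR.
  by apply: continuousM; [exact: cst_continuous|exact: norm_continuous].
- by move=> x _; rewrite lee_fin sker_le_abs.
Qed.

(** This is the Beta integral of [s^(t-1) / (s + 1)] over [s > 0], that is [pi / sin (pi t)]; it
    serves as a normalising constant. *)
Definition smass (t : R) : R := fine (\int[mu]_w (sker t 1 w)%:E).

Lemma integral_sker1 t : 0 < t < 1 -> (\int[mu]_w (sker t 1 w)%:E = (smass t)%:E)%E.
Proof.
move=> t01; rewrite fineK// ge0_fin_numE ?sker_lty//.
by apply: integral_ge0 => w _; rewrite lee_fin sker_ge0.
Qed.

Lemma smass_gt0 t : 0 < t < 1 -> 0 < smass t.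
Proof.
move=> t01; rewrite -lte_fin -integral_sker1//.
apply: (@lt_le_trans _ _ (\int[mu]_(w in `[0%R, 1%R]) (cst ((expR 1 + 1)^-1)%:E w))%E).
  rewrite integral_cst//= lebesgue_measure_itv/= lte_fin ltr01 oppr0 adde0 mule1.
  by rewrite lte_fin invr_gt0 addr_gt0// expR_gt0.
apply: (@le_trans _ _ (\int[mu]_(w in `[0%R, 1%R]) (sker t 1 w)%:E)%E).
  apply: ge0_le_integral => //.
  - by move=> x _; rewrite lee_fin invr_ge0 addr_ge0// expR_ge0.
  - apply/measurable_EFinP; apply: measurable_funTS.
    by apply: continuous_measurable_fun; exact: continuous_sker.
  - move=> x /=; rewrite in_itv/= => /andP[x0 x1].
    rewrite lee_fin -[leLHS]mul1r ler_pM ?invr_ge0 ?addr_ge0 ?expR_ge0//.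
    + rewrite -expR0 ler_expR mulr_ge0//; by case/andP: t01 => /ltW.
    + by rewrite lef_pV2 ?posrE ?addr_gt0 ?expR_gt0// lerD2r ler_expR.
apply: ge0_subset_integral => //.
- by apply/measurable_EFinP; apply: continuous_measurable_fun; exact: continuous_sker.
- by move=> x _; rewrite lee_fin sker_ge0.
Qed.

(** Scaling [s] by [x] is the translation of [w] by [ln x]; it takes [x^t] out of the numerator and
    [x] out of the denominator. *)
Lemma integral_sker t x : 0 < t < 1 -> 0 < x ->
  (\int[mu]_w (sker t x w)%:E = (x `^ (t - 1) * smass t)%:E)%E.
Proof.
move=> t01 x0.
have dF (w : R) : is_derive w 1 (fun w : R => w + ln x) (1 : R).
  by apply: is_derive_eq; rewrite addr0.
have F' : (fun w : R => w + ln x)^`() = cst (1 : R).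
  by apply/funext => w; rewrite derive1E derive_val.
rewrite (@increasing_ge0_integration_by_substitutionT _ (fun w => w + ln x)).
- rewrite EFinM -integral_sker1// -ge0_integralZl//; first last.
  + by rewrite lee_fin powR_ge0.
  + by move=> w _; rewrite lee_fin sker_ge0.
  + by apply/measurable_EFinP; apply: continuous_measurable_fun; exact: continuous_sker.
  apply: eq_integral => w _; rewrite F' /= -EFinM; congr EFin.
  rewrite !fctE mulr1 /sker mulrDr !expRD lnK ?posrE// -[in LHS]/(powR _ _) .
  rewrite [expR (t * ln x)](_ : _ = x `^ t); last by rewrite /powR gt_eqF.
  rewrite [x `^ (t - 1)](_ : _ = x `^ t / x); last first.
    by rewrite powRB ?(gt_eqF x0) ?implybT// powRr1 ?ltW.
  by field; rewrite !gt_eqF ?addr_gt0 ?mulr_gt0 ?expR_gt0.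
- by move=> a b ab; rewrite ltrD2r.
- by rewrite F'; exact: cst_continuous.
- by rewrite F'; exact: is_cvg_cst.
- by rewrite F'; exact: is_cvg_cst.
- by move=> w; exact: ex_derive.
- apply/cvgrNyPle => A; near=> w.
  by rewrite -lerBrDr; near: w; apply: nbhs_ninfty_le; exact: num_real.
- apply/cvgryPge => A; near=> w.
  by rewrite -lerBlDr; near: w; apply: nbhs_pinfty_ge; exact: num_real.
- exact/continuous_sker/ltW.
- by move=> w; exact/sker_ge0/ltW.
Unshelve. all: by end_near. Qed.

Lemma integrable_scale d (T : measurableType d) (m : {measure set T -> \bar R})
    (A : set T) (f : T -> R) (c : R) : measurable A ->
  m.-integrable A (EFin \o f) -> m.-integrable A (EFin \o (fun z => c * f z)).
Proof.
by move=> mA If; apply: eq_integrable (integrableZl mA c If) => // x _ /=; rewrite EFinM.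
Qed.

Lemma integrable_add d (T : measurableType d) (m : {measure set T -> \bar R})
    (A : set T) (f g : T -> R) : measurable A ->
  m.-integrable A (EFin \o f) -> m.-integrable A (EFin \o g) ->
  m.-integrable A (EFin \o (fun z => f z + g z)).
Proof.
by move=> mA If Ig; apply: eq_integrable (integrableD mA If Ig) => // x _ /=; rewrite EFinD.
Qed.

Lemma Rintegral_comb d (T : measurableType d) (m : {measure set T -> \bar R})
    (A : set T) (n : nat) (c : nat -> R) (f : nat -> T -> R) : measurable A ->
  (forall k, m.-integrable A (EFin \o f k)) ->
  m.-integrable A (EFin \o (fun z => \sum_(k < n) c k * f k z)) /\
  \int[m]_(z in A) (\sum_(k < n) c k * f k z) = \sum_(k < n) c k * \int[m]_(z in A) f k z.
Proof.
move=> mA If; elim: n => [|n [ih1 ih2]].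
  split; first by under eq_fun do rewrite big_ord0; exact: integrable0.
  rewrite big_ord0; under eq_Rintegral do rewrite big_ord0.
  by rewrite /Rintegral integral0.
have im := integrable_scale (c n) mA (If n).
split.
  have := integrable_add mA ih1 im.
  by apply: eq_integrable => // w _ /=; rewrite big_ord_recr.
rewrite big_ord_recr/= -ih2 -RintegralZl// -RintegralD//.
by apply: eq_Rintegral => w _; rewrite big_ord_recr.
Qed.

(** * Moments of [1 / (s + x)] on the unit interval, and their means over [s] *)

Definition cmom (s : R) (k : nat) : R := \int[mu]_(x in `[0, 1]) (x ^+ k / (s + x)).

Lemma continuous_cmom_fun s k : 0 < s ->
  {within `[0, 1]%classic, continuous (fun x : R => x ^+ k / (s + x))}.
Proof.
move=> s0; apply: continuous_in_subspaceT => x /set_mem /=; rewrite in_itv/= => /andP[x0 x1].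
apply: (@continuousM _ _ (fun x => x ^+ k) (fun x => (s + x)^-1)).
  exact: exprn_continuous.
apply: continuousV; first by rewrite gt_eqF// ltr_wpDr.
by apply: continuousD; [exact: cst_continuous|exact: cvg_id].
Qed.

Lemma integrable_cmom s k : 0 < s ->
  mu.-integrable `[0, 1] (EFin \o (fun x : R => x ^+ k / (s + x))).
Proof.
move=> s0; apply: continuous_compact_integrable; first exact: segment_compact.
exact: continuous_cmom_fun.
Qed.

Lemma integral_powR01 (a : R) : 0 < a ->
  (\int[mu]_(x in `[0%R, 1%R]) (x `^ a)%:E = ((a + 1)^-1)%:E)%E.
Proof.
move=> a0; have a10 : 0 < a + 1 by rewrite addr_gt0.
have c0 (b : R) : 0 < b -> x `^ b @[x --> 0^'+] --> (0 `^ b : R).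
  by move=> b0; rewrite powR0 ?gt_eqF//; exact: powR_cvg0.
have cp (b x : R) : 0 < x -> {for x, continuous (@powR R ^~ b)}.
  move=> x0; apply: differentiable_continuous; apply/derivable1_diffP.
  by apply: derivable_powR; rewrite in_itv/= x0.
have a1 : a + 1 != 0 by rewrite gt_eqF.
rewrite (@continuous_FTC2 _ _ (fun x => (a + 1)^-1 * x `^ (a + 1)))//.
- by rewrite powR1 powR0// mulr0 mulr1 sube0.
- apply/continuous_within_itvP => //; split.
  + by move=> x; rewrite in_itv/= => /andP[x0 _]; exact: cp.
  + exact: c0.
  + by apply: cvg_at_left_filter; exact: cp.
- split.
  + move=> x; rewrite in_itv/= => /andP[x0 _]; apply: derivableM => //.
    by apply: derivable_powR; rewrite in_itv/= x0.
  + by apply: cvgM; [exact: cvg_cst|exact: c0].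
  + by apply: cvgM; [exact: cvg_cst|apply: cvg_at_left_filter; exact: cp].
- move=> x; rewrite in_itv/= => /andP[x0 _].
  rewrite derive1Ml//; last by apply: derivable_powR; rewrite in_itv/= x0.
  by rewrite powR_derive1 ?in_itv/= ?x0// mulrA mulVf// mul1r addrK.
Qed.

Lemma Rintegral_Xn k : \int[mu]_(x in `[0, 1]) (x ^+ k) = k.+1%:R^-1 :> R.
Proof.
rewrite /Rintegral.
rewrite (@continuous_FTC2 _ _ (fun x => k.+1%:R^-1 * x ^+ k.+1))//=.
- by rewrite expr1n expr0n/= mulr0 mulr1 subr0.
- by apply: continuous_in_subspaceT => x _; exact: exprn_continuous.
- split.
  + by move=> x _; apply: derivableM => //; exact: exprn_derivable.
  + apply: cvg_at_right_filter; apply: cvgM; first exact: cvg_cst.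
    exact: exprn_continuous.
  + apply: cvg_at_left_filter; apply: cvgM; first exact: cvg_cst.
    exact: exprn_continuous.
- move=> x _; rewrite derive1Ml; last exact: exprn_derivable.
  by rewrite derive1E exp_derive scaler1/= mulrA mulVf ?mul1r// pnatr_eq0.
Qed.

Lemma cmom_ge0 s k : 0 < s -> 0 <= cmom s k.
Proof.
move=> s0; apply: Rintegral_ge0 => x /=; rewrite in_itv/= => /andP[x0 _].
by rewrite divr_ge0 ?exprn_ge0// addr_ge0// ltW.
Qed.

Lemma integrable_Xn k : mu.-integrable `[0, 1] (EFin \o (fun x : R => x ^+ k)).
Proof.
apply: continuous_compact_integrable; first exact: segment_compact.
by apply: continuous_in_subspaceT => x _; exact: exprn_continuous.
Qed.

Lemma cmom_le s k : 0 < s -> cmom s k <= s^-1 * k.+1%:R^-1.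
Proof.
move=> s0; rewrite -Rintegral_Xn -RintegralZl//; last exact: integrable_Xn.
apply: le_Rintegral => //; first exact: integrable_cmom.
  by apply: integrable_scale => //; exact: integrable_Xn.
move=> x /=; rewrite in_itv/= => /andP[x0 _].
by rewrite mulrC ler_wpM2r ?exprn_ge0// lef_pV2 ?posrE ?ltr_wpDr// lerDl.
Qed.

(** Integrate [s / (s + x) = 1 - x / (s + x)] against [x^k]. *)
Lemma cmomS s k : 0 < s -> s * cmom s k = k.+1%:R^-1 - cmom s k.+1.
Proof.
move=> s0; rewrite -Rintegral_Xn -RintegralB//; last 2 first.
- exact: integrable_Xn.
- exact: integrable_cmom.
rewrite -RintegralZl//; last exact: integrable_cmom.
apply: eq_Rintegral => x /set_mem /=; rewrite in_itv/= => /andP[x0 _].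
by rewrite exprS; field; rewrite gt_eqF// ltr_wpDr.
Qed.

(* The real power [-1] is measurable and agrees with the inverse on the support. *)
Definition joint_ker t k (z : R * R) : R :=
  expR (t * z.1) * z.2 ^+ k * (expR z.1 + z.2) `^ (-1) * \1_`[0, 1] z.2.

Lemma measurable_joint_ker t k : measurable_fun setT (joint_ker t k).
Proof.
apply: measurable_funM; last first.
  by apply: (measurableT_comp (f := (\1_`[0, 1] : R -> R))).
apply: measurable_funM; last first.
  apply: (measurableT_comp (measurable_powR (- 1 : R))).
  apply: measurable_funD => //.
  exact: (measurableT_comp (@measurable_expR R)).
apply: measurable_funM; last exact: measurable_funX.
apply: (measurableT_comp (@measurable_expR R)).
exact: measurable_funM.
Qed.

Lemma joint_kerE t k w x : 0 <= x <= 1 ->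
  joint_ker t k (w, x) = expR (t * w) * (x ^+ k / (expR w + x)).
Proof.
move=> /andP[x0 x1]; rewrite /joint_ker /= indicE mem_set /=; last by rewrite in_itv/= x0 x1.
by rewrite powR_inv1 ?addr_ge0 ?expR_ge0// mulr1 mulrA.
Qed.

Lemma joint_ker_out t k w x : ~~ (0 <= x <= 1) -> joint_ker t k (w, x) = 0.
Proof.
move=> x01; rewrite /joint_ker /= indicE memNset /=; first by rewrite mulr0.
by rewrite in_itv/=; apply/negP.
Qed.

Lemma joint_ker_ge0 t k z : 0 <= joint_ker t k z.
Proof.
case: z => w x; have [x01|x01] := boolP (0 <= x <= 1).
  rewrite joint_kerE//; case/andP: x01 => x0 _.
  by rewrite mulr_ge0 ?expR_ge0// divr_ge0 ?exprn_ge0// addr_ge0// expR_ge0.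
by rewrite joint_ker_out.
Qed.

Lemma integral_joint_kerl t k w :
  (\int[mu]_x (joint_ker t k (w, x))%:E = (expR (t * w) * cmom (expR w) k)%:E)%E.
Proof.
transitivity (\int[mu]_(x in `[0%R, 1%R]) ((expR (t * w))%:E * (x ^+ k / (expR w + x))%:E))%E.
  rewrite [RHS]integral_mkcond; apply: eq_integral => x _; rewrite patchE.
  have [|x01] := boolP (x \in `[0, 1]%classic).
    by rewrite inE/= in_itv/= => x01; rewrite joint_kerE.
  by rewrite joint_ker_out//; apply: contra x01; rewrite inE/= in_itv.
have ig := integrable_cmom k (expR_gt0 w).
rewrite integralZl// EFinM /cmom /Rintegral fineK//.
exact: integrable_fin_num ig.
Qed.

(** The exponent [k.+1] absorbs the singular factor [x^(t-1)] and makes the kernel vanish at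
    [x = 0], where the transform formula does not apply. *)
Lemma integral_joint_kerr t k x : 0 < t < 1 ->
  (\int[mu]_w (joint_ker t k.+1 (w, x))%:E =
   ((smass t * x `^ (k%:R + t)) * \1_`[0, 1] x)%:E)%E.
Proof.
move=> t01; have t0 : 0 < t by case/andP: t01.
have [x01|x01] := boolP (0 <= x <= 1); last first.
  rewrite indicE memNset/= ?in_itv/=; last exact/negP.
  rewrite mulr0; apply: integral0_eq => w _; by rewrite joint_ker_out.
rewrite indicE mem_set/= ?in_itv/= // mulr1.
under eq_integral do rewrite joint_kerE//.
case/andP: x01; rewrite le_eqVlt => /predU1P[<- _|x0 x1].
  rewrite powR0 ?gt_eqF ?ltr_wpDl// mulr0.
  by apply: integral0_eq => w _; rewrite expr0n/= mul0r mulr0.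
transitivity (\int[mu]_w ((x ^+ k.+1)%:E * (sker t x w)%:E))%E.
  by apply: eq_integral => w _; rewrite -EFinM /sker mulrCA.
rewrite ge0_integralZl//; last 3 first.
- apply/measurable_EFinP; apply: continuous_measurable_fun.
  exact/continuous_sker/ltW.
- by move=> w _; rewrite lee_fin sker_ge0// ltW.
- by rewrite lee_fin exprn_ge0// ltW.
rewrite integral_sker// -EFinM; congr EFin.
rewrite mulrA mulrC; congr (_ * _).
rewrite -powR_mulrn ?ltW// -powRD; last by rewrite (gt_eqF x0) implybT.
by congr (_ `^ _); rewrite -natr1; ring.
Qed.

(** By Tonelli, integrating in [w] first leaves a multiple of [x^(k+t)], whose integral over the
    unit interval is [1 / (k + 1 + t)]. *)
Lemma integral_expR_cmom t k : 0 < t < 1 ->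
  (\int[mu]_w (expR (t * w) * cmom (expR w) k.+1)%:E =
   (smass t / (k.+1%:R + t))%:E)%E.
Proof.
move=> t01; have t0 : 0 < t by case/andP: t01.
under eq_integral do rewrite -integral_joint_kerl.
rewrite (@fubini_tonelli _ _ _ _ _ mu mu (fun z => (joint_ker t k.+1 z)%:E)); last 2 first.
- by apply/measurable_EFinP; exact: measurable_joint_ker.
- by move=> z; rewrite lee_fin joint_ker_ge0.
under eq_integral do rewrite integral_joint_kerr//.
transitivity (\int[mu]_(x in `[0%R, 1%R]) ((smass t)%:E * (x `^ (k%:R + t))%:E))%E.
  rewrite [RHS]integral_mkcond; apply: eq_integral => x _; rewrite patchE indicE.
  by case: ifPn => _; rewrite ?mulr1 ?mulr0.
rewrite ge0_integralZl//; last 3 first.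
- by apply/measurable_EFinP; apply: measurable_funTS; exact: measurable_powR.
- by move=> w _; rewrite lee_fin powR_ge0.
- by rewrite lee_fin ltW// smass_gt0.
rewrite integral_powR01 ?ltr_wpDl// -EFinM.
by congr (_ / _)%:E; rewrite -natr1; ring.
Qed.

Lemma measurable_cmom k : measurable_fun setT (fun w : R => cmom (expR w) k).
Proof.
apply/measurable_EFinP.
have -> : EFin \o (fun w : R => cmom (expR w) k) =
    (fun w => \int[mu]_x (joint_ker 0 k (w, x))%:E)%E.
  by apply/funext => w /=; rewrite integral_joint_kerl mul0r expR0 mul1r.
apply: (@measurable_fun_fubini_tonelli_F _ _ _ _ _ mu (fun z => (joint_ker 0 k z)%:E)).
- by apply/measurable_EFinP; exact: measurable_joint_ker.
- by move=> z; rewrite lee_fin joint_ker_ge0.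
Qed.

(** In the variable [s = expR w] this is [s^t / (s + 1) ds] divided by [smass t], the scaling for
    which [1 / s] has integral 1. *)
Definition smeas (t w : R) : R := (smass t)^-1 * (sker t 1 w * expR w).

Lemma smeas_ge0 t w : 0 < t < 1 -> 0 <= smeas t w.
Proof.
by move=> t01; rewrite !mulr_ge0 ?expR_ge0 ?invr_ge0 ?(ltW (smass_gt0 t01))// sker_ge0.
Qed.

Lemma measurable_smeas t : measurable_fun setT (smeas t).
Proof.
apply: measurable_funM => //; apply: measurable_funM; last exact: measurable_expR.
by apply: continuous_measurable_fun; exact: continuous_sker.
Qed.

Lemma integral_smeas_expRN t : 0 < t < 1 ->
  (\int[mu]_w (smeas t w * (expR w)^-1)%:E = 1)%E.
Proof.
move=> t01; have m0 := smass_gt0 t01.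
transitivity (\int[mu]_w (((smass t)^-1)%:E * (sker t 1 w)%:E))%E.
  apply: eq_integral => w _; rewrite /smeas -EFinM mulrA mulfK//.
  by rewrite gt_eqF ?expR_gt0.
rewrite ge0_integralZl//; last 3 first.
- by apply/measurable_EFinP; apply: continuous_measurable_fun; exact: continuous_sker.
- by move=> w _; rewrite lee_fin sker_ge0.
- by rewrite lee_fin invr_ge0 ltW.
by rewrite integral_sker1// -EFinM mulVf// gt_eqF.
Qed.

Lemma integrable_smeas_expRN t : 0 < t < 1 ->
  mu.-integrable setT (EFin \o (fun w => smeas t w * (expR w)^-1)).
Proof.
move=> t01; apply/integrableP; split.
  apply/measurable_EFinP; apply: measurable_funM; first exact: measurable_smeas.
  apply: continuous_measurable_fun => w; apply: continuousV; last exact: continuous_expR.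
  by rewrite gt_eqF ?expR_gt0.
rewrite (_ : integral _ _ _ = 1%E) ?ltry// -(integral_smeas_expRN t01).
apply: eq_integral => w _; rewrite /= ger0_norm//.
by rewrite mulr_ge0 ?smeas_ge0// invr_ge0 expR_ge0.
Qed.

Lemma integrable_smeas_cmom t k : 0 < t < 1 ->
  mu.-integrable setT (EFin \o (fun w => smeas t w * cmom (expR w) k)).
Proof.
move=> t01; apply: (le_integrable _ _ _ (integrable_smeas_expRN t01)) => //.
  apply/measurable_EFinP; apply: measurable_funM; first exact: measurable_smeas.
  exact: measurable_cmom.
move=> w _ /=; rewrite lee_fin !ger0_norm; last 2 first.
- by rewrite mulr_ge0 ?smeas_ge0// invr_ge0 expR_ge0.
- by rewrite mulr_ge0 ?smeas_ge0// cmom_ge0 ?expR_gt0.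
rewrite ler_wpM2l ?smeas_ge0// (le_trans (cmom_le _ (expR_gt0 _)))//.
by rewrite ler_piMr ?invr_ge0 ?expR_ge0// invf_le1 ?ler1n.
Qed.

Definition smom t k : R := \int[mu]_w (smeas t w * cmom (expR w) k).

Lemma smom_ge0 t k : 0 < t < 1 -> 0 <= smom t k.
Proof.
by move=> t01; apply: Rintegral_ge0 => w _; rewrite mulr_ge0 ?smeas_ge0// cmom_ge0 ?expR_gt0.
Qed.

Lemma Rintegral_smeas_expRN t : 0 < t < 1 ->
  \int[mu]_w (smeas t w * (expR w)^-1) = 1.
Proof. by move=> t01; rewrite /Rintegral integral_smeas_expRN. Qed.

Lemma smom_le t k : 0 < t < 1 -> smom t k <= k.+1%:R^-1.
Proof.
move=> t01; set c : R := _^-1; rewrite -[leRHS]mul1r -(Rintegral_smeas_expRN t01).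
rewrite -RintegralZr//; last exact: integrable_smeas_expRN.
apply: le_Rintegral => //; first exact: integrable_smeas_cmom.
  under eq_fun do rewrite mulrC.
  by apply: integrable_scale => //; exact: integrable_smeas_expRN.
by move=> w _; rewrite -mulrA ler_wpM2l ?smeas_ge0// cmom_le ?expR_gt0.
Qed.

(* Pointwise in [s], [s (g_k - g_(k+1)) / (s + 1) = 1 / ((k+1) (s+1)) - g_(k+1)] for the
   moments [g_k] of [1 / (s + x)]; the last term is integrated by Tonelli. *)
Lemma smomB t k : 0 < t < 1 ->
  smom t k - smom t k.+1 = k.+1%:R^-1 - (k.+1%:R + t)^-1.
Proof.
move=> t01; have m0 := smass_gt0 t01.
rewrite /smom -RintegralB//; [|exact: integrable_smeas_cmom..].
have -> : (k.+1%:R + t)^-1 = \int[mu]_w ((smass t)^-1 * (expR (t * w) * cmom (expR w) k.+1)).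
  rewrite /Rintegral; under eq_integral do rewrite EFinM.
  rewrite ge0_integralZl//; last 3 first.
  - apply/measurable_EFinP; apply: measurable_funM; last exact: measurable_cmom.
    by apply: continuous_measurable_fun; exact: continuous_expRM.
  - by move=> w _; rewrite lee_fin mulr_ge0 ?expR_ge0 ?cmom_ge0 ?expR_gt0.
  - by rewrite lee_fin invr_ge0 ltW.
  by rewrite integral_expR_cmom//= mulrA mulVf ?mul1r// gt_eqF.
have ik : mu.-integrable setT
    (EFin \o (fun w => smeas t w * (expR w)^-1 * k.+1%:R^-1)).
  under eq_fun do rewrite mulrC.
  by apply: integrable_scale => //; exact: integrable_smeas_expRN.
set c : R := k.+1%:R^-1; rewrite -[X in _ = X - _]mul1r -(Rintegral_smeas_expRN t01).
rewrite -RintegralZr//; last exact: integrable_smeas_expRN.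
have pt w : smeas t w * cmom (expR w) k - smeas t w * cmom (expR w) k.+1 =
   smeas t w * (expR w)^-1 * k.+1%:R^-1 - (smass t)^-1 * (expR (t * w) * cmom (expR w) k.+1).
  have := cmomS k (expR_gt0 w); have := expR_gt0 w.
  rewrite /smeas /sker; set E := expR w; set E' := expR (t * w).
  move=> E0 /(canRL (mulKf _)) ->; last by rewrite gt_eqF.
  have E1 : E + 1 != 0 by rewrite gt_eqF// addr_gt0.
  by field; rewrite E1 !gt_eqF// ltr0n.
rewrite -RintegralB//.
  by apply: eq_Rintegral => w _; exact: pt.
(* The Tonelli term remains to be shown integrable; by [pt] it is a combination of three integrable
   functions. *)
have := integrable_add measurableT ik (integrable_scale (-1) measurableT
  (integrable_add measurableT (integrable_smeas_cmom k t01)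
  (integrable_scale (-1) measurableT (integrable_smeas_cmom k.+1 t01)))).
by apply: eq_integrable => // w _ /=; rewrite !mulN1r pt; congr EFin; ring.
Qed.

(** The pointwise bound [D / s] integrates to [D], because [1 / s] has mass 1; the bound is thus
    uniform in [t]. *)
Lemma smom_comb_le t (n : nat) (co : nat -> R) (idx : nat -> nat) (D : R) :
  0 < t < 1 ->
  (forall s, 0 < s -> `|\sum_(k < n) co k * cmom s (idx k)| <= D / s) ->
  `|\sum_(k < n) co k * smom t (idx k)| <= D.
Proof.
move=> t01 HD.
have [iE <-] := Rintegral_comb n co measurableT
  (fun k => integrable_smeas_cmom (idx k) t01).
apply: (le_trans (le_normr_Rintegral measurableT iE)).
rewrite -[leRHS]mul1r -(Rintegral_smeas_expRN t01).
rewrite -RintegralZr//; last exact: integrable_smeas_expRN.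
apply: le_Rintegral => //.
- exact: integrable_norm iE.
- under eq_fun do rewrite mulrC.
  by apply: integrable_scale => //; exact: integrable_smeas_expRN.
move=> w _; under eq_bigr do rewrite mulrCA.
rewrite -mulr_sumr normrM (ger0_norm (smeas_ge0 _ _))// -mulrA.
by rewrite ler_wpM2l ?smeas_ge0// mulrC HD// expR_gt0.
Qed.

End kernel.

(** * Euler's constant as a limit of Stieltjes moments *)

Section euler.
Local Open Scope classical_set_scope.
Context {R : realType}.

Lemma ln_divB_le (x y : R) : 0 < x -> 0 < y -> ln y - ln x <= y / x - 1.
Proof.
move=> x0 y0; rewrite -ln_div ?posrE//.
have -> : y / x = 1 + (y / x - 1) by ring.
by rewrite [1 + _]addrC addrK addrC le_ln1Dx// ltrBrDl addrN divr_gt0.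
Qed.

Lemma ln_divB_ge (x y : R) : 0 < x -> 0 < y -> 1 - x / y <= ln y - ln x.
Proof. by move=> x0 y0; have := ln_divB_le y0 x0; lra. Qed.

Lemma euler_SB k : euler_S R k.+1 - euler_S R k = k.+1%:R^-1 - (ln k.+2%:R - ln k.+1%:R).
Proof. by rewrite /euler_S seriesSr /=; ring. Qed.

Lemma ln_nat_bounds k :
  (k.+2%:R : R)^-1 <= ln (k.+2%:R : R) - ln k.+1%:R <= k.+1%:R^-1.
Proof.
have k1 : 0 < k.+1%:R :> R by rewrite ltr0n.
have k2 : 0 < k.+2%:R :> R by rewrite ltr0n.
apply/andP; split.
  apply: le_trans (ln_divB_ge k1 k2).
  have -> : k.+1%:R = k.+2%:R - 1 :> R by rewrite -[k.+2]addn1 natrD addrK.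
  by rewrite mulrBl divff ?gt_eqF// mul1r opprB addrC subrK.
apply: le_trans (ln_divB_le k1 k2) _.
by rewrite -[k.+2]addn1 natrD mulrDl divff ?gt_eqF// mul1r addrC addKr.
Qed.

Lemma euler_S_nd : nondecreasing_seq (euler_S R).
Proof.
apply/nondecreasing_seqP => k; rewrite -subr_ge0 euler_SB subr_ge0.
by case/andP: (ln_nat_bounds k).
Qed.

Lemma euler_S_le k : euler_S R k <= 1 - k.+1%:R^-1.
Proof.
elim: k => [|k ih].
  by rewrite /euler_S /series /= big_geq// ln1 invr1 !subrr.
have := euler_SB k; have /andP[+ _] := ln_nat_bounds k.
move: ih; set x := k.+1%:R^-1; set y := k.+2%:R^-1; set l := ln _ - ln _.
by move: x y l => x y l; lra.
Qed.

Lemma cvg_euler_S : euler_S R @ \oo --> euler_gamma R.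
Proof.
have cS : cvgn (euler_S R).
  apply: nondecreasing_is_cvgn; first exact: euler_S_nd.
  exists 1 => _ [k _ <-]; apply: le_trans (euler_S_le k) _.
  by rewrite lerBlDr lerDl invr_ge0.
(* The two sequences use [ln n] and [ln (n + 1)]: after a shift of the index they differ by a
   harmonic term tending to 0. *)
have H : (fun n : nat => series (@harmonic R) n - ln n%:R) @ \oo --> limn (euler_S R).
  rewrite -cvg_shiftS.
  rewrite (_ : [sequence _]_n = (fun n => euler_S R n + harmonic n)); last first.
    by apply/funext => n /=; rewrite /euler_S seriesSr addrAC.
  by rewrite -[limn _]addr0; apply: cvgD => //; exact: cvg_harmonic.
by rewrite /euler_gamma (cvg_lim _ H).
Qed.

(* The moment is only defined for [0 < t]; [t = 0] contributes nothing to the mean. *)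
Definition smom0 (t : R) (k : nat) : R := if t == 0 then 0 else smom t k.

Lemma smom0_bounds t k : 0 <= t < 1 -> 0 <= smom0 t k <= k.+1%:R^-1.
Proof.
rewrite /smom0; case: eqVneq => [_ _|t0 /andP[t0' t1]]; first by rewrite lexx invr_ge0/=.
have t01 : 0 < t < 1 by rewrite lt_neqAle eq_sym t0 t0' t1.
by rewrite smom_ge0// smom_le.
Qed.

Lemma smom0B t k : 0 <= t < 1 ->
  smom0 t k - smom0 t k.+1 = k.+1%:R^-1 - (k.+1%:R + t)^-1.
Proof.
rewrite /smom0; case: eqVneq => [-> _|t0 /andP[t0' t1]]; first by rewrite addr0 !subrr.
by rewrite smomB// lt_neqAle eq_sym t0 t0' t1.
Qed.

Lemma smom0_comb_le t (n : nat) (co : nat -> R) (idx : nat -> nat) (D : R) :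
  0 <= t < 1 ->
  (forall s, 0 < s -> `|\sum_(k < n) co k * cmom s (idx k)| <= D / s) ->
  `|\sum_(k < n) co k * smom0 t (idx k)| <= D.
Proof.
move=> t01 HD; rewrite /smom0; case: eqVneq => [_|t0].
  rewrite big1 ?normr0; last by move=> i _; rewrite mulr0.
  by have := HD 1 ltr01; rewrite divr1; exact: le_trans.
by apply: smom_comb_le => //; case/andP: t01 => t0' ->; rewrite lt_neqAle eq_sym t0 t0'.
Qed.

(** A Riemann sum for the mean over [t] in [[0, 1]]. The mean of [1 / (k + 1 + t)] is
    [ln (k + 2) - ln (k + 1)], so by [smom0B] the decrements in [k] approach the increments of
    [euler_S]. *)
Definition mean_smom (T k : nat) : R := T.+1%:R^-1 * \sum_(j < T.+1) smom0 (j%:R / T.+1%:R) k.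

Lemma frac01 (T : nat) (j : 'I_T.+1) : 0 <= j%:R / (T.+1%:R : R) < 1.
Proof. by rewrite divr_ge0//= ltr_pdivrMr ?ltr0n// mul1r ltr_nat ltn_ord. Qed.

Lemma mean_smom_bounds T k : 0 <= mean_smom T k <= k.+1%:R^-1.
Proof.
rewrite /mean_smom mulr_ge0 ?invr_ge0 ?sumr_ge0//=; last first.
  by move=> j _; case/andP: (smom0_bounds k (frac01 j)).
rewrite ler_pdivrMl ?ltr0n//.
apply: le_trans (_ : \sum_(j < T.+1) k.+1%:R^-1 <= _); last first.
  by rewrite sumr_const card_ord mulr_natl.
by apply: ler_sum => j _; case/andP: (smom0_bounds k (frac01 j)).
Qed.

Lemma mean_smom_comb_le T (n : nat) (co : nat -> R) (idx : nat -> nat) (D : R) :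
  (forall s, 0 < s -> `|\sum_(k < n) co k * cmom s (idx k)| <= D / s) ->
  `|\sum_(k < n) co k * mean_smom T (idx k)| <= D.
Proof.
move=> HD.
rewrite (eq_bigr (fun k : 'I_n => T.+1%:R^-1 *
   \sum_(j < T.+1) co k * smom0 (j%:R / T.+1%:R) (idx k))); last first.
  by move=> k _; rewrite /mean_smom mulrCA mulr_sumr.
rewrite -mulr_sumr exchange_big/= normrM ger0_norm ?invr_ge0// ler_pdivrMl ?ltr0n//.
apply: le_trans (ler_norm_sum _ _ _) _.
apply: le_trans (_ : \sum_(j < T.+1) D <= _); last first.
  by rewrite sumr_const card_ord mulr_natl.
by apply: ler_sum => j _; apply: smom0_comb_le HD; exact: frac01.
Qed.

(* Left and right Riemann sums of [1 / y] over [[k+1, k+2]] enclose the logarithm. *)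
Lemma mean_smomB T k :
  let d := mean_smom T k - mean_smom T k.+1 - (euler_S R k.+1 - euler_S R k) in
  `|d| <= T.+1%:R^-1 * (k.+1%:R^-1 - k.+2%:R^-1).
Proof.
have T0 : 0 < T.+1%:R :> R by rewrite ltr0n.
have k0 : 0 < k.+1%:R :> R by rewrite ltr0n.
pose y (j : nat) : R := k.+1%:R + j%:R / T.+1%:R.
have y0 j : 0 < y j by rewrite ltr_wpDr// divr_ge0.
have yS j : y j.+1 = y j + T.+1%:R^-1 by rewrite /y -natr1; field; rewrite gt_eqF.
have -> : mean_smom T k - mean_smom T k.+1 =
    k.+1%:R^-1 - \sum_(j < T.+1) T.+1%:R^-1 * (y j)^-1.
  rewrite /mean_smom -mulrBr -sumrB (eq_bigr (fun j : 'I_T.+1 => k.+1%:R^-1 - (y j)^-1)).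
    rewrite sumrB sumr_const card_ord mulrBr -mulr_sumr; congr (_ - _).
    by rewrite -[k.+1%:R^-1 *+ T.+1]mulr_natr mulrCA mulVf ?mulr1// gt_eqF.
  by move=> j _; rewrite smom0B ?frac01.
have tel (f : nat -> R) : \sum_(j < T.+1) (f j.+1 - f j) = f T.+1 - f 0%N.
  by rewrite -(big_mkord xpredT (fun j => f j.+1 - f j)) telescope_sumr.
have yT : y T.+1 = k.+2%:R by rewrite /y divff ?gt_eqF// -[k.+2]addn1 natrD.
have y00 : y 0%N = k.+1%:R by rewrite /y mul0r addr0.
have := tel (fun j => ln (y j)); rewrite /= yT y00 => lntel.
have up : ln k.+2%:R - ln k.+1%:R <= \sum_(j < T.+1) T.+1%:R^-1 * (y j)^-1.
  rewrite -lntel; apply: ler_sum => j _; apply: le_trans (ln_divB_le _ _) _ => //.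
  by rewrite yS mulrDl divff ?gt_eqF// addrC addKr.
have dn : \sum_(j < T.+1) T.+1%:R^-1 * (y j.+1)^-1 <= ln k.+2%:R - ln k.+1%:R.
  rewrite -lntel; apply: ler_sum => j _; apply: le_trans (ln_divB_ge _ _) => //.
  have -> : y j = y j.+1 - T.+1%:R^-1 by rewrite yS addrK.
  by rewrite mulrBl divff ?gt_eqF// opprB addrC subrK.
have := tel (fun j => T.+1%:R^-1 * (y j)^-1).
rewrite sumrB yT y00 -mulrBr => tl.
rewrite euler_SB /=; move: up dn tl.
move: (\sum_(j < _) _ / y j.+1) (\sum_(j < _) _ / y j) (ln _ - ln _) => x z l.
rewrite -(opprB k.+1%:R^-1) mulrN; move: (T.+1%:R^-1 * _) => w; move: (k.+1%:R^-1) => v ? ? ?.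
by rewrite ler_norml; apply/andP; split; lra.
Qed.

(** The error [d] and the majorant [h] both tend to 0 in [k], and the steps of [d] are bounded by
    those of [h]. So [d - h] increases to 0 and [d + h] decreases to 0, whence [d] lies between
    [- h] and [h]. *)
Lemma mean_smom_approx T k :
  `|mean_smom T k - (euler_gamma R - euler_S R k)| <= T.+1%:R^-1.
Proof.
pose d k := mean_smom T k - (euler_gamma R - euler_S R k).
pose h (k : nat) : R := T.+1%:R^-1 * k.+1%:R^-1.
have hle k' : h k' <= T.+1%:R^-1.
  by rewrite ler_piMr ?invr_ge0// invf_le1 ?ler1n ?ltr0n.
have cd : d @ \oo --> (0 : R).
  rewrite -[X in _ --> X](subrr 0) -[X in _ --> _ - X](subrr (euler_gamma R)).
  apply: cvgB; last by apply: cvgB; [exact: cvg_cst|exact: cvg_euler_S].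
  apply: (@squeeze_cvgr _ _ _ _ (cst 0) (@harmonic R)); last exact: cvg_harmonic.
    by apply: nearW => n; exact: mean_smom_bounds.
  exact: cvg_cst.
have ch : h @ \oo --> (0 : R).
  rewrite -(mulr0 (T.+1%:R^-1)); apply: cvgM; first exact: cvg_cst.
  exact: cvg_harmonic.
have step j : `|d j - d j.+1| <= h j - h j.+1.
  have -> : d j - d j.+1 = mean_smom T j - mean_smom T j.+1 -
      (euler_S R j.+1 - euler_S R j).
    rewrite /d; move: (mean_smom T j) (mean_smom T j.+1) (euler_S R j) (euler_S R j.+1).
    by move=> a b a' b'; ring.
  by have := mean_smomB T j; rewrite /= mulrBr.
have up : d k - h k <= 0.
  have c : (fun j => d j - h j) @ \oo --> (0 : R).
    by rewrite -(subrr 0); apply: cvgB.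
  rewrite -(cvg_lim _ c)//; apply: (@nondecreasing_cvgn_le _ (fun j => d j - h j)).
    by apply/nondecreasing_seqP => j; have := step j; rewrite ler_norml => /andP[]; lra.
  by apply/cvg_ex; exists 0.
have dn : 0 <= d k + h k.
  have c : (fun j => d j + h j) @ \oo --> (0 : R).
    by rewrite -(addr0 0); apply: cvgD.
  rewrite -(cvg_lim _ c)//; apply: (@nonincreasing_cvgn_ge _ (fun j => d j + h j)).
    by apply/nonincreasing_seqP => j; have := step j; rewrite ler_norml => /andP[]; lra.
  by apply/cvg_ex; exists 0.
change (`|d k| <= T.+1%:R^-1).
have := hle k; move: up dn; move: (d k) (h k) (T.+1%:R^-1) => x y z ? ? ?.
by rewrite ler_norml; apply/andP; split; lra.
Qed.

(** The bound [D] for the mean moments does not depend on [T], and replacing them by [gamma - S]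
    costs at most the sum of [|co k|] over [T + 1]; let [T] grow. *)
Lemma euler_comb_le (n : nat) (co : nat -> R) (idx : nat -> nat) (D : R) :
  (forall s, 0 < s -> `|\sum_(k < n) co k * cmom s (idx k)| <= D / s) ->
  `|\sum_(k < n) co k * (euler_gamma R - euler_S R (idx k))| <= D.
Proof.
move=> HD; apply/ler_addgt0Pr => e e0.
pose S := \sum_(k < n) `|co k|.
have S0 : 0 <= S by exact: sumr_ge0.
have [T ST] : exists T : nat, S / T.+1%:R <= e.
  exists (Num.bound (S / e)); rewrite ler_pdivrMr ?ltr0n// mulrC -ler_pdivrMr//.
  apply: le_trans (ltW (archi_boundP _)) _; first by rewrite divr_ge0// ltW.
  by rewrite ler_nat.
have := mean_smom_comb_le T HD.
set A := \sum_(k < n) _ => HA; set B := \sum_(k < n) _.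
have AB : `|B - A| <= S / T.+1%:R.
  rewrite -sumrB mulr_suml; apply: le_trans (ler_norm_sum _ _ _) _.
  apply: ler_sum => k _; rewrite -mulrBr normrM ler_wpM2l// distrC.
  exact: mean_smom_approx.
have -> : B = A + (B - A) by ring.
exact: le_trans (ler_normD _ _) (lerD HA (le_trans AB ST)).
Qed.

End euler.

(** * Alternating sums and integration by parts *)

Section alternating_sum.
Context {R : realType}.
Implicit Types (r a : R) (al : seq R) (N : nat).

Definition altsum N (F : nat -> R) : R := \sum_(k < N.+1) (-1) ^+ k * 'C(N, k)%:R * F k.

Lemma altsum_ext N F G : F =1 G -> altsum N F = altsum N G.
Proof. by move=> FG; apply: eq_bigr => k _; rewrite FG. Qed.

Lemma altsumD N F G : altsum N (fun k => F k + G k) = altsum N F + altsum N G.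
Proof. by rewrite -big_split; apply: eq_bigr => k _ /=; rewrite mulrDr. Qed.

Lemma altsumZ N c F : altsum N (fun k => c * F k) = c * altsum N F.
Proof. by rewrite mulr_sumr; apply: eq_bigr => k _; rewrite mulrCA. Qed.

Lemma altsum_natM N F :
  altsum N.+1 (fun k => k%:R * F k) = - N.+1%:R * altsum N (F \o succn).
Proof.
rewrite /altsum big_ord_recl mul0r mulr0 add0r mulr_sumr; apply: eq_bigr => k _ /=.
rewrite /bump /= add1n exprS; have := mul_bin_diag N.+1 k => /= /(congr1 (fun n => n%:R : R)).
rewrite !natrM => E.
transitivity (- (-1) ^+ k * (k.+1%:R * 'C(N.+1, k.+1)%:R) * F k.+1); first by ring.
by rewrite -E; ring.
Qed.

Definition linprod r al (k : nat) : R := \prod_(a <- al) (r * k%:R + a).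

(** An [N]-th finite difference kills degrees below [N] and sees only the leading coefficient in
    degree [N]. Splitting off a factor [r k + a], the part with [a] has lower degree, and the part
    with [r k] lowers [N] by absorption while shifting the other factors by [r]. *)
Lemma altsum_linprod r N al : (size al <= N)%N ->
  altsum N (linprod r al) = if size al == N then (- r) ^+ N * N`!%:R else 0.
Proof.
elim: N al => [|N ih] al.
  rewrite leqn0 => /nilP ->; rewrite /altsum big_ord_recl big_ord0 /linprod big_nil /=.
  by rewrite bin0 !expr0 fact0 !mulr1 addr0.
elim: al => [_|a al iha] /=.
  (* The empty product gives the binomial expansion of [(1 - 1)^(N+1)]. *)
  have := exprDn (1 : R) (-1) N.+1; rewrite subrr expr0n /= => E.
  rewrite [RHS]E; apply: eq_bigr => k _.
  by rewrite /linprod big_nil expr1n mul1r mulr1 mulr_natr.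
rewrite ltnS eqSS => sN.
have -> : altsum N.+1 (linprod r (a :: al)) =
    a * altsum N.+1 (linprod r al) + r * altsum N.+1 (fun k => k%:R * linprod r al k).
  rewrite -!altsumZ -altsumD; apply: altsum_ext => k.
  by rewrite /linprod big_cons; ring.
rewrite iha ?(leq_trans sN)// ltn_eqF ?ltnS// mulr0 add0r altsum_natM.
have -> : altsum N (linprod r al \o succn) = altsum N (linprod r (map (+%R r) al)).
  apply: altsum_ext => k /=; rewrite /linprod big_map; apply: eq_bigr => b _.
  by rewrite -natr1; ring.
rewrite ih ?size_map//; case: eqP => _; last by rewrite !mulr0.
by rewrite factS exprS natrM; ring.
Qed.

End alternating_sum.

(** * Moments of monomials in [x], [u] and [v] *)

Section moments.
Local Open Scope classical_set_scope.
Context {R : realType}.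
Notation mu := (@lebesgue_measure R).
Variable s : R.
Hypothesis s0 : 0 < s.
Implicit Types (e i j : nat) (x : R).

(* [x^e u^i v^j] with [u = x / (s + x)] and [v = s / (s + x)]. *)
Definition uvmon (e i j : nat) (x : R) : R := s ^+ j * (x ^+ (e + i) * (s + x)^-1 ^+ (i + j)).

Lemma sDx_neq0 x : 0 <= x -> s + x != 0.
Proof. by move=> x0; rewrite gt_eqF// ltr_wpDr. Qed.

Lemma is_derive_expfrac (p q : nat) x : 0 <= x ->
  is_derive x 1 (fun y : R => y ^+ p * (s + y)^-1 ^+ q)
    (p%:R * x ^+ p.-1 * (s + x)^-1 ^+ q - q%:R * x ^+ p * (s + x)^-1 ^+ q.+1).
Proof.
move=> x0; have sx := sDx_neq0 x0.
have d1 : is_derive x (1 : R) (fun y : R => s + y) (1 : R).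
  by have := is_deriveD (is_derive_cst s x (1 : R)) (is_derive_id x (1 : R)); rewrite add0r.
have dV := @is_deriveV _ _ _ _ _ sx d1.
have dW := is_deriveX q dV.
have dX := is_deriveX p (is_derive_id x (1 : R)).
have -> : (fun y : R => y ^+ p * (s + y)^-1 ^+ q) =
    ((id : R -> R) ^+ p) * ((fun y : R => (s + y)^-1) ^+ q).
  by apply/funext => y; rewrite [RHS]/GRing.mul /= !exprfctE.
apply: (is_derive_eq (is_deriveM dX dW)).
rewrite /GRing.scale/= !exprfctE /= -exprVn; move: ((s + x)^-1) => w.
by case: q {dW} => [|q] /=; rewrite ?exprS; ring.
Qed.

Lemma within_uvmon e i j : {within `[0, 1]%classic, continuous (uvmon e i j)}.
Proof.
apply: continuous_in_subspaceT => x /set_mem /=; rewrite in_itv/= => /andP[x0 _].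
apply: differentiable_continuous; apply/derivable1_diffP.
apply: derivableM => //; have [] // := is_derive_expfrac (e + i) (i + j) x0.
Qed.

Lemma integrable_uvmon e i j : mu.-integrable `[0, 1] (EFin \o uvmon e i j).
Proof.
apply: continuous_compact_integrable; first exact: segment_compact.
exact: within_uvmon.
Qed.

Definition uvmom e i j : R := \int[mu]_(x in `[0, 1]) (uvmon e i j x).

(** This is [u + v = 1]. *)
Lemma uvmon_split e i j x : 0 <= x ->
  uvmon e i j x = uvmon e i.+1 j x + uvmon e i j.+1 x.
Proof.
move=> /sDx_neq0 sx; rewrite /uvmon addnS addSn addnS !exprS.
set w := _ ^+ (i + j); set y := x ^+ _; set z := s ^+ j.
by rewrite -[w in LHS]mul1r -(mulVf sx); ring.
Qed.

Lemma uvmom_split e i j : uvmom e i j = uvmom e i.+1 j + uvmom e i j.+1.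
Proof.
rewrite /uvmom -RintegralD//; [|exact: integrable_uvmon..].
apply: eq_Rintegral => x /set_mem /=; rewrite in_itv/= => /andP[x0 _].
exact: uvmon_split.
Qed.

(** Both derivatives are explicit in [u] and [v]: [x u' = u v] and [x v' = - u v]. *)
Lemma is_derive_uvmon e i j x : 0 <= x ->
  is_derive x 1 (uvmon e.+1 i j)
    (e.+1%:R * uvmon e i j x + (i%:R * uvmon e i j.+1 x - j%:R * uvmon e i.+1 j x)).
Proof.
move=> x0; have sx := sDx_neq0 x0.
apply: (is_derive_eq (is_deriveZ (s ^+ j) (is_derive_expfrac (e.+1 + i) (i + j) x0))).
rewrite /uvmon /GRing.scale/= !addSn !addnS !exprS !natrD -!natr1 natrD.
set w := _ ^+ (i + j); set y := x ^+ _; set z := s ^+ j.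
by field.
Qed.

(* Integration by parts: the boundary term does not depend on [e]. *)
Lemma uvmom_ibp e i j :
  e.+1%:R * uvmom e i j + (i%:R * uvmom e i j.+1 - j%:R * uvmom e i.+1 j) = uvmon 0 i j 1.
Proof.
rewrite /uvmom -!RintegralZl//; [|exact: integrable_uvmon..].
have Iz c e' i' j' : mu.-integrable `[0, 1] (EFin \o (fun x => c * uvmon e' i' j' x)).
  by apply: integrable_scale => //; exact: integrable_uvmon.
have Iz2 : mu.-integrable `[0, 1]
    (EFin \o (fun x => i%:R * uvmon e i j.+1 x - j%:R * uvmon e i.+1 j x)).
  have /(_ (measurable_itv _)) := (fun mA =>
    integrable_add mA (Iz i%:R e i j.+1) (Iz (- j%:R) e i.+1 j)).
  by apply: eq_integrable => // x _ /=; rewrite mulNr.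
rewrite -RintegralB// -RintegralD// /Rintegral.
rewrite (@continuous_FTC2 _ _ (uvmon e.+1 i j))//.
- rewrite /= [X in _ - X](_ : _ = 0) ?subr0; last by rewrite /uvmon addSn expr0n/= mul0r mulr0.
  by rewrite /uvmon !expr1n.
- apply: continuous_in_subspaceT => x /set_mem /=; rewrite in_itv/= => /andP[x0 _].
  apply: differentiable_continuous; apply/derivable1_diffP.
  have D e' i' j' : derivable (uvmon e' i' j') x 1.
    by apply: derivableM => //; have [] := is_derive_expfrac (e' + i') (i' + j') x0.
  by apply: derivableD; [|apply: derivableB]; apply: derivableM.
- split.
  + by move=> x; rewrite in_itv/= => /andP[/ltW x0 _]; have [] := is_derive_uvmon e i j x0.
  + have [d _] := is_derive_uvmon e i j (lexx (0 : R)).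
    by apply: cvg_at_right_filter; apply: differentiable_continuous; apply/derivable1_diffP.
  + have [d _] := is_derive_uvmon e i j (@ler01 R).
    by apply: cvg_at_left_filter; apply: differentiable_continuous; apply/derivable1_diffP.
- move=> x; rewrite in_itv/= => /andP[/ltW x0 _].
  by have [_ <-] := is_derive_uvmon e i j x0; rewrite derive1E.
Qed.

(** From [x v = s - s v]. *)
Lemma uvmom01S e : uvmom e.+1 0 1 = s * e.+1%:R^-1 - s * uvmom e 0 1.
Proof.
rewrite -Rintegral_Xn /uvmom -!RintegralZl//; [|exact: integrable_uvmon|exact: integrable_Xn].
rewrite -RintegralB//; last 2 first.
- by apply: integrable_scale => //; exact: integrable_Xn.
- by apply: integrable_scale => //; exact: integrable_uvmon.
apply: eq_Rintegral => x /set_mem /=; rewrite in_itv/= => /andP[x0 _].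
by rewrite /uvmon !addn0 add0n !expr1 exprS; field; exact: sDx_neq0.
Qed.

Lemma uvmom_cmom e : uvmom e 0 1 = s * cmom s e.
Proof.
rewrite /uvmom /cmom -RintegralZl//; last exact: integrable_cmom.
by apply: eq_Rintegral => x _; rewrite /uvmon addn0 add0n !expr1.
Qed.

(** From [x v = s u]. *)
Lemma uvmom_shift e i : uvmom e.+1 i 1 = s * uvmom e i.+1 0.
Proof.
rewrite /uvmom -RintegralZl//; last exact: integrable_uvmon.
by apply: eq_Rintegral => x _; rewrite /uvmon expr1 expr0 mul1r !addSn !addnS !addn0.
Qed.

End moments.

(** * Absorbing the linear factors into the integrand *)

Section reduction.
Local Open Scope classical_set_scope.
Context {R : realType}.
Notation mu := (@lebesgue_measure R).
Variables (s : R) (r N : nat).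
Hypothesis s0 : 0 < s.
Implicit Types (al : seq R) (e i j : nat).

Definition uvsum al e i j : R :=
  altsum N (fun k => linprod r%:R al k * uvmom s (r * k + e) i j).

(** Integration by parts trades the factor [r k + e + 1] for a change of exponents; the term with
    [d] is spread over the same two monomials by [u + v = 1]. *)
Lemma uvsum_step al e i j (d : R) : (size al < N)%N ->
  uvsum (e.+1%:R - d :: al) e i j =
  - ((i%:R + d) * uvsum al e i j.+1 + (d - j%:R) * uvsum al e i.+1 j).
Proof.
move=> sN.
(* The boundary term is constant in [k] and multiplies a polynomial of degree less than [N]. *)
have E0 : altsum N (fun k => uvmon s 0 i j 1 * linprod r%:R al k) = 0.
  by rewrite altsumZ altsum_linprod ?ltn_eqF ?mulr0// ltnW.
rewrite -[RHS]addr0 -{}E0 /uvsum -!altsumZ -altsumD -[- altsum _ _]mulN1r -altsumZ -altsumD.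
apply: altsum_ext => k; rewrite -(uvmom_ibp s0 (r * k + e)) /linprod big_cons -/(linprod _ _ _).
have := uvmom_split s0 (r * k + e) i j => E.
have -> : (r * k + e).+1%:R = r%:R * k%:R + e.+1%:R :> R.
  by rewrite -addnS natrD natrM.
move: (linprod _ _ _) (uvmom _ _ i j) (uvmom _ _ i.+1 j) (uvmom _ _ i j.+1) E => l m m1 m2 ->.
ring.
Qed.

(** Each power of [x] is removed by [uvmom01S]. Its rational term has a denominator equal to a
    factor of the product; after cancellation the degree is below [N] and the sum vanishes, so only
    [- s] survives. *)
Lemma uvsum_drop_pow al e q : (size al <= N)%N ->
  (forall h, (h < q)%N -> (e + h).+1%:R \in al) ->
  uvsum al (e + q) 0 1 = (- s) ^+ q * uvsum al e 0 1.
Proof.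
move=> sN; elim: q => [|q ih] Hal; first by rewrite addn0 expr0 mul1r.
rewrite exprS -mulrA -ih; last by move=> h hq; apply: Hal; exact: ltnW.
have qal := Hal q (ltnSn q).
have E0 : altsum N (linprod r%:R (rem (e + q).+1%:R al)) = 0.
  rewrite altsum_linprod size_rem// ?ltn_eqF//; last exact: leq_trans (leq_pred _) sN.
  rewrite prednK//; last by case: (al) qal.
rewrite addnS -[RHS]add0r -[X in X + _](mulr0 s) -{}E0 -!altsumZ -altsumD.
apply: altsum_ext => k; rewrite addnS uvmom01S//.
rewrite {1}/linprod (perm_big _ (perm_to_rem qal)) big_cons -/(linprod _ _ _) /=.
rewrite [linprod r%:R al k](_ : _ = (r%:R * k%:R + (e + q).+1%:R) *
    linprod r%:R (rem (e + q).+1%:R al) k); last first.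
  by rewrite {1}/linprod (perm_big _ (perm_to_rem qal)) big_cons.
have -> : (r * k + (e + q)).+1%:R = r%:R * k%:R + (e + q).+1%:R :> R.
  by rewrite -addnS natrD natrM.
have H : r%:R * k%:R + (e + q).+1%:R != 0 :> R.
  by rewrite -natrM -natrD addnS pnatr_eq0.
by field.
Qed.

(** In [uvsum_step] with [d = - i] and [j = 1] the coefficient [i + d] is zero, so a single monomial
    remains, with coefficient [i + 1]. *)
Lemma uvsum_first_block (c : nat) al e i : (c + size al <= N)%N ->
  uvsum ([seq (e.+1 + h)%:R | h <- iota i c] ++ al) e i 1 =
  (\prod_(h <- iota i c) h.+1%:R) * uvsum al e (i + c) 1.
Proof.
elim: c i => [|c ih] i sN; first by rewrite /= big_nil mul1r addn0.
rewrite /= big_cons (_ : (e.+1 + i)%:R = e.+1%:R - - i%:R); last by rewrite opprK natrD.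
rewrite uvsum_step; last by rewrite size_cat size_map size_iota.
rewrite subrr mul0r add0r ih ?(leq_trans _ sN)// ?ltnW//.
rewrite addSnnS -natr1; ring.
Qed.

End reduction.

(** * Domination by Bernstein polynomials *)

Section bernstein.
Local Open Scope classical_set_scope.
Context {R : realType}.
Notation mu := (@lebesgue_measure R).
Variables (s : R) (r N : nat).
Hypothesis s0 : 0 < s.

(** Insert the upper bounds for [a0] and [a1], both of whose coefficients are nonnegative as
    [S < d]. Pascal's rule and [(i+1) C(S,i+1) = (S-i) C(S,i)] then leave the slack [L l C(S,i)]. *)
Lemma bernstein_coef_le (l d S i : nat) (L a0 a1 : R) : (S < d)%N ->
  a0 <= L * 'C(S, i)%:R -> a1 <= L * 'C(S, i.+1)%:R -> 0 <= L ->
  (l + i.+1 + d)%:R * a1 + (d%:R - S%:R + i%:R) * a0 <=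
  L * (l + d)%:R * 'C(S.+1, i.+1)%:R.
Proof.
move=> Sd a0L a1L L0.
have dS : 0 <= d%:R - S%:R + i%:R :> R by rewrite addr_ge0// subr_ge0 ler_nat ltnW.
apply: le_trans (lerD (ler_wpM2l (ler0n _ _) a1L) (ler_wpM2l dS a0L)) _.
have E : i.+1%:R * 'C(S, i.+1)%:R = (S%:R - i%:R) * 'C(S, i)%:R :> R.
  have [iS|Si] := leqP i S.
    by rewrite -natrB// -!natrM -mul_bin_left.
  by rewrite !bin_small ?mulr0// ltnW.
have -> : (l + i.+1 + d)%:R * (L * 'C(S, i.+1)%:R) + (d%:R - S%:R + i%:R) * (L * 'C(S, i)%:R) =
    L * ((l%:R + d%:R) * 'C(S, i.+1)%:R +
      i.+1%:R * 'C(S, i.+1)%:R + (d%:R - S%:R + i%:R) * 'C(S, i)%:R).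
  by rewrite !natrD; ring.
rewrite E binS natrD natrD -mulrA ler_wpM2l//.
rewrite -subr_ge0 (_ : _ - _ = l%:R * 'C(S, i)%:R) ?mulr_ge0//; ring.
Qed.

(** Each factor raises the degree [S] of a form in [u] and [v] by one. Since [ds] increases strictly
    from above [S], every [d] exceeds the current degree, which keeps the coefficients
    nonnegative. *)
Lemma uvsum_rest (ds : seq nat) (S : nat) (a : nat -> R) (L : R) (l e : nat) :
  (size ds <= N)%N -> path ltn S ds ->
  (forall i, 0 <= a i <= L * 'C(S, i)%:R) ->
  exists a' : nat -> R,
    (forall i, 0 <= a' i <= L * (\prod_(d <- ds) (l + d)%:R) * 'C(S + size ds, i)%:R) /\
    \sum_(i < S.+1) a i * uvsum s r N [seq e.+1%:R - d%:R | d <- ds] e (l + i) (S - i) =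
    (-1) ^+ size ds *
    \sum_(i < (S + size ds).+1) a' i * uvsum s r N [::] e (l + i) (S + size ds - i).
Proof.
elim: ds S a L => [|d ds ih] S a L sN pds aL.
  by exists a; rewrite big_nil mulr1 addn0 expr0 mul1r.
move: pds => /= /andP[Sd pds].
have L0 : 0 <= L.
  have /andP[h1 h2] := aL 0%N; apply: le_trans h1 (le_trans h2 _).
  by rewrite bin0 mulr1.
(* The new coefficients, read off from [uvsum_step] at the exponents [l + i] and [S - i]. *)
pose b (i : nat) : R := (l + i + d)%:R * a i +
  (if i is i'.+1 then (d%:R - S%:R + i'%:R) * a i' else 0).
have bL i : 0 <= b i <= L * (l + d)%:R * 'C(S.+1, i)%:R.
  have /andP[ai0 aiL] := aL i.
  case: i ai0 aiL => [|i] ai0 aiL.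
    rewrite /b addr0 addn0 mulr_ge0//= bin0 mulr1 mulrC ler_wpM2r//.
    by rewrite bin0 mulr1 in aiL.
  have /andP[bi0 biL] := aL i.
  rewrite /b bernstein_coef_le// andbT addr_ge0 ?mulr_ge0//.
  by rewrite addr_ge0// subr_ge0 ler_nat ltnW.
have pSds : path ltn S.+1 ds.
  by case: (ds) pds => //= d' ds' /andP[dd' ->]; rewrite andbT (leq_ltn_trans Sd).
have [a' [a'L E]] := ih S.+1 b (L * (l + d)%:R) (ltnW sN) pSds bL.
exists a'; split.
  by move=> i; rewrite big_cons mulrA /= addnS -addSn.
rewrite /= addnS -addSn exprS -mulrA -E mulN1r -sumrN.
pose P := uvsum s r N [seq e.+1%:R - d0%:R | d0 <- ds] e.
have PE i : (i <= S)%N ->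
   uvsum s r N (e.+1%:R - d%:R :: [seq e.+1%:R - d0%:R | d0 <- ds]) e (l + i) (S - i) =
   - ((l + i + d)%:R * P (l + i)%N (S.+1 - i)%N +
      (d%:R - S%:R + i%:R) * P (l + i.+1)%N (S - i)%N).
  move=> iS; rewrite uvsum_step ?size_map// -subSn// addnS -natrD natrB//.
  by congr (- (_ + _ * _)); ring.
transitivity (- \sum_(i < S.+1) ((l + i + d)%:R * a i * P (l + i)%N (S.+1 - i)%N +
    (d%:R - S%:R + i%:R) * a i * P (l + i.+1)%N (S - i)%N)).
  rewrite -sumrN; apply: eq_bigr => i _; rewrite PE; last by rewrite -ltnS.
  by move: (P _ _) (P (l + i.+1)%N _) => p1 p2; ring.
rewrite sumrN; congr (- _); rewrite -/P.
transitivity (\sum_(i < S.+2) ((l + i + d)%:R * a i * P (l + i)%N (S.+1 - i)%N +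
   (if nat_of_ord i is i'.+1 then (d%:R - S%:R + i'%:R) * a i' else 0) *
     P (l + i)%N (S.+1 - i)%N)); last first.
  by apply: eq_bigr => i _; rewrite -mulrDl.
rewrite !big_split/=; congr (_ + _).
  have -> : \sum_(i < S.+2) (l + i + d)%:R * a i * P (l + i)%N (S.+1 - i)%N =
     \sum_(i < S.+1) (l + i + d)%:R * a i * P (l + i)%N (S.+1 - i)%N +
     (l + S.+1 + d)%:R * a S.+1 * P (l + S.+1)%N (S.+1 - S.+1)%N by rewrite big_ord_recr.
  (* The added top term vanishes because its binomial bound is zero. *)
  have -> : a S.+1 = 0.
    by apply/eqP; rewrite eq_le andbC; have := aL S.+1; rewrite bin_small// mulr0.
  by rewrite mulr0 mul0r addr0.
by rewrite [RHS]big_ord_recl/= mul0r add0r.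
Qed.

Lemma uvsum_nil e i j : uvsum s r N [::] e i j =
  \int[mu]_(x in `[0, 1]) ((1 - x ^+ r) ^+ N * uvmon s e i j x).
Proof.
have /(_ (measurable_itv _)) [_ E] := (fun mA => Rintegral_comb N.+1
  (fun k => (-1) ^+ k * 'C(N, k)%:R) mA (fun k => integrable_uvmon s0 (r * k + e) i j)).
transitivity (\sum_(k < N.+1) (-1) ^+ k * 'C(N, k)%:R * uvmom s (r * k + e) i j).
  by apply: eq_bigr => k _; rewrite /linprod big_nil mul1r.
rewrite -E; apply: eq_Rintegral => x _.
rewrite exprDn mulr_suml; apply: eq_bigr => k _.
rewrite expr1n mul1r -mulr_natr /uvmon [(- x ^+ r) ^+ k]exprNn -exprM -addnA exprD; ring.
Qed.

Lemma integrable_onem_uvmon e i j :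
  mu.-integrable `[0, 1] (EFin \o (fun x => (1 - x ^+ r) ^+ N * uvmon s e i j x)).
Proof.
apply: continuous_compact_integrable; first exact: segment_compact.
apply: continuous_in_subspaceT => x /set_mem /=; rewrite in_itv/= => /andP[x0 _].
apply: differentiable_continuous; apply/derivable1_diffP.
apply: derivableM; last first.
  by apply: derivableM => //; have [] := is_derive_expfrac s0 (e + i) (i + j) x0.
have -> : (fun y : R => (1 - y ^+ r) ^+ N) = (cst 1 - (id : R -> R) ^+ r) ^+ N.
  by apply/funext => y; rewrite exprfctE /= [(_ - _) y]/(_ - _) /= exprfctE.
by apply: derivableX; apply: derivableB => //; exact: derivableX.
Qed.

Lemma pow_onem_ge0 (x : R) : 0 <= x <= 1 -> 0 <= (1 - x ^+ r) ^+ N.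
Proof. by move=> /andP[x0 x1]; rewrite exprn_ge0// subr_ge0 exprn_ile1. Qed.

Lemma uvmon_ge0 e i j x : 0 <= x -> 0 <= uvmon s e i j x.
Proof.
by move=> x0; rewrite !mulr_ge0 ?exprn_ge0 ?invr_ge0 ?addr_ge0// ltW.
Qed.

(** The binomial expansion of [(u + v)^S = 1]. *)
Lemma uvmon_binom e l S x : 0 <= x ->
  \sum_(i < S.+1) 'C(S, i)%:R * uvmon s e (l + i) (S - i) x = uvmon s e l 0 x.
Proof.
move=> x0; have sx := sDx_neq0 s0 x0.
have -> : uvmon s e l 0 x = uvmon s e l 0 x * (s * (s + x)^-1 + x * (s + x)^-1) ^+ S.
  by rewrite -mulrDl divff// expr1n mulr1.
rewrite exprDn mulr_sumr; apply: eq_bigr => i _.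
have iS : (i <= S)%N by rewrite -ltnS.
rewrite /uvmon addn0 -addnA subnKC// expr0 mul1r -mulr_natr !exprMn addnA exprD.
have -> : (s + x)^-1 ^+ (l + S) = (s + x)^-1 ^+ l * (s + x)^-1 ^+ (S - i) * (s + x)^-1 ^+ i.
  by rewrite -!exprD -addnA subnK.
by move: ((s + x)^-1) => w; ring.
Qed.

Lemma uvsum_nil_comb_le e l S (a : nat -> R) (L : R) :
  (forall i, 0 <= a i <= L * 'C(S, i)%:R) ->
  `|\sum_(i < S.+1) a i * uvsum s r N [::] e (l + i) (S - i)| <=
  L * uvsum s r N [::] e l 0.
Proof.
move=> aL; under eq_bigr do rewrite uvsum_nil.
have /(_ (measurable_itv _)) [iE <-] := (fun mA => Rintegral_comb S.+1 a mA
  (fun i => integrable_onem_uvmon e (l + i) (S - i))).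
rewrite uvsum_nil -RintegralZl//; last exact: integrable_onem_uvmon.
rewrite ger0_norm; last first.
  apply: Rintegral_ge0 => x /=; rewrite in_itv/= => x01.
  apply: sumr_ge0 => i _; have /andP[ai _] := aL i.
  have x0 : 0 <= x by case/andP: x01.
  by rewrite mulr_ge0// mulr_ge0 ?pow_onem_ge0 ?uvmon_ge0.
apply: le_Rintegral => //.
  by apply: integrable_scale => //; exact: integrable_onem_uvmon.
move=> x /=; rewrite in_itv/= => x01; have /andP[x0 x1] := x01.
rewrite -(uvmon_binom e l S x0) !mulr_sumr; apply: ler_sum => i _.
have /andP[_ ai] := aL i.
have := ler_wpM2r (mulr_ge0 (pow_onem_ge0 x01) (uvmon_ge0 e (l + i) (S - i) x0)) ai.
by move/le_trans; apply; rewrite le_eqVlt; apply/orP; left; apply/eqP; ring.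
Qed.

(** The first block is used twice: its factors first cancel the denominators that appear when [x^q]
    is dropped, then raise the power of [u] to [c]. Exchanging [x v] for [s u] turns [e.+1] into
    [e], the base from which the factors of [ds] are absorbed. *)
Lemma cauchy_moment_sum_le (c q e : nat) (ds : seq nat) :
  (q <= c)%N -> N = (c + size ds)%N -> path ltn 0 ds ->
  `|altsum N (fun k =>
      linprod r%:R ([seq (e.+2 + h)%:R | h <- iota 0 c] ++ [seq e.+1%:R - d%:R | d <- ds]) k
      * cmom s (r * k + (e.+1 + q)))| <=
  c`!%:R * (\prod_(d <- ds) (c.+1 + d)%:R) * (s ^+ q * uvsum s r N [::] e c.+1 0).
Proof.
move=> qc NE pds.
set al := _ ++ _.
have sal : size al = N by rewrite size_cat !size_map size_iota NE.
have -> : altsum N (fun k => linprod r%:R al k * cmom s (r * k + (e.+1 + q))) =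
    s^-1 * uvsum s r N al (e.+1 + q) 0 1.
  rewrite -altsumZ; apply: altsum_ext => k; rewrite uvmom_cmom//.
  by rewrite mulrCA mulKf// gt_eqF.
rewrite uvsum_drop_pow ?sal//; last first.
  move=> h hq; rewrite mem_cat; apply/orP; left; apply/mapP; exists h; last by rewrite addSn.
  by rewrite mem_iota add0n (leq_trans hq).
rewrite uvsum_first_block ?size_map -?NE// add0n.
have -> : \prod_(h <- iota 0 c) h.+1%:R = c`!%:R :> R.
  by rewrite fact_prod natr_prod big_add1/= /index_iota subn0.
set rest := map _ ds.
have -> : uvsum s r N rest e.+1 c 1 = s * uvsum s r N rest e c.+1 0.
  rewrite -altsumZ; apply: altsum_ext => k; rewrite addnS uvmom_shift//; ring.
have sN : (size ds <= N)%N by rewrite NE leq_addl.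
(* The starting form is the constant 1, of degree 0. *)
have a1 i : 0 <= (if i == 0%N then 1 else 0 : R) <= 1 * 'C(0, i)%:R.
  by case: i => [|i] /=; rewrite bin0n/= ?mulr1 ?mulr0 ?ler01 ?lexx.
have [a' [a'L]] := uvsum_rest c.+1 e sN pds a1.
rewrite big_ord_recl big_ord0 addr0 mul1r addn0 subn0 -/rest => ->.
rewrite !normrM normfV !normrX normrN1 expr1n mul1r normrN (gtr0_norm s0) (ger0_norm (ler0n _ _)).
have := uvsum_nil_comb_le e c.+1 a'L; rewrite mul1r => H.
set U := `|_| in H *.
have -> : s^-1 * (s ^+ q * (c`!%:R * (s * U))) = c`!%:R * s ^+ q * U.
  by field; rewrite gt_eqF.
set V := uvsum _ _ _ _ _ _ _ in H *; set D := \prod_(d <- ds) _ in H *.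
rewrite [leRHS](_ : _ = c`!%:R * s ^+ q * (D * V)); last by ring.
by rewrite ler_wpM2l// mulr_ge0// exprn_ge0// ltW.
Qed.

End bernstein.

(** * Weighted AM-GM and the remaining integral *)

Section optimum.
Context {R : realType}.

(* From [1 + y <= exp y], applied to the two ratios to the maximiser [p / (p + q)]. *)
Lemma exp_amgm (p q : nat) (u v : R) : 0 <= u -> 0 <= v -> u + v = 1 ->
  u ^+ p * v ^+ q * (p + q)%:R ^+ (p + q) <= p%:R ^+ p * q%:R ^+ q.
Proof.
move=> u0 v0 uv1.
have [->|p0] := posnP p.
  by rewrite !expr0 !mul1r add0n ler_piMl ?exprn_ge0// exprn_ile1//; lra.
have [->|q0] := posnP q.
  by rewrite !expr0 !mulr1 addn0 ler_piMl ?exprn_ge0// exprn_ile1//; lra.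
have pR : 0 < p%:R :> R by rewrite ltr0n.
have qR : 0 < q%:R :> R by rewrite ltr0n.
have key (w : R) (k : nat) : 0 < k%:R :> R -> 0 <= w ->
    (w * (p + q)%:R / k%:R) ^+ k <= expR (w * (p + q)%:R - k%:R).
  move=> k0 w0.
  have -> : w * (p + q)%:R - k%:R = (w * (p + q)%:R / k%:R - 1) * k%:R.
    by field; rewrite gt_eqF.
  rewrite expRM_natr lerXn2r ?nnegrE ?expR_ge0 ?divr_ge0 ?mulr_ge0//.
  by have := expR_ge1Dx (w * (p + q)%:R / k%:R - 1); rewrite addrC subrK.
have := ler_pM (exprn_ge0 _ (divr_ge0 (mulr_ge0 u0 (ler0n _ (p + q))) (ltW pR)))
  (exprn_ge0 _ (divr_ge0 (mulr_ge0 v0 (ler0n _ (p + q))) (ltW qR)))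
  (key u p pR u0) (key v q qR v0).
rewrite -expRD (_ : _ - _ + _ = 0); last first.
  have -> : v = 1 - u by lra.
  by rewrite natrD; ring.
rewrite expR0 !expr_div_n mulf_div ler_pdivrMr ?mulr_gt0 ?exprn_gt0// mul1r.
by rewrite !exprMn exprD mulrACA.
Qed.

(** Raising to the power [r] clears the exponents [b / r]; what remains is [exp_amgm] at [u = x^r]
    with exponents [b] and [C r]. *)
Lemma root_amgm (r b C : nat) (x : R) : (0 < r)%N -> (0 < b)%N -> 0 <= x <= 1 ->
  x ^+ b * (1 - x ^+ r) ^+ C <=
  r%:R ^+ C * (b%:R `^ (b%:R / r%:R) * C%:R ^+ C / (b + C * r)%:R `^ (C%:R + b%:R / r%:R)).
Proof.
move=> r0 b0 /andP[x0 x1].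
have rR : 0 < r%:R :> R by rewrite ltr0n.
have B0 : 0 < (b + C * r)%:R :> R by rewrite ltr0n ltn_addr.
have xr : 0 <= 1 - x ^+ r by rewrite subr_ge0 exprn_ile1.
rewrite -(@ler_pXn2r _ r)//; last 2 first.
- by rewrite nnegrE mulr_ge0 ?exprn_ge0.
- by rewrite nnegrE !mulr_ge0 ?invr_ge0 ?powR_ge0 ?exprn_ge0.
have powE (a y : R) (k : nat) : 0 <= a -> y * r%:R = k%:R -> (a `^ y) ^+ r = a ^+ k.
  by move=> a0 yk; rewrite -powR_mulrn ?powR_ge0// -powRrM yk powR_mulrn.
rewrite !exprMn exprVn (powE _ _ b) ?divfK ?gt_eqF//.
rewrite (powE _ _ (b + C * r)%N) ?ler0n//; last first.
  by rewrite natrD natrM; field; rewrite gt_eqF.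
have := exp_amgm b (C * r) (exprn_ge0 r x0) xr (subrKC _ _).
rewrite -!exprM (mulnC r b) natrM exprMn => H.
rewrite mulrA ler_pdivlMr ?exprn_gt0//; apply: le_trans H _.
by rewrite [leRHS]mulrC mulrA.
Qed.

End optimum.

Section integral_bound.
Local Open Scope classical_set_scope.
Context {R : realType}.
Notation mu := (@lebesgue_measure R).

Definition amgm_max (p q : nat) : R := p%:R ^+ p * q%:R ^+ q / (p + q)%:R ^+ (p + q).

(** Times [r^C], this is the maximum of [x^b (1 - x^r)^C] on [[0, 1]], attained at
    [x^r = b / (b + C r)]. *)
Definition root_max (r b C : nat) : R :=
  b%:R `^ (b%:R / r%:R) * C%:R ^+ C / (b + C * r)%:R `^ (C%:R + b%:R / r%:R).

Lemma uvsum_nil_le (s : R) (r b C p q n e k : nat) : 0 < s -> (0 < r)%N -> (0 < b)%N ->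
  (0 < p + q)%N -> (e + q * n = b * n + k)%N ->
  s ^+ (q * n) * uvsum s r (C * n) [::] e ((p + q) * n).+1 0 <=
  (amgm_max p q * (r%:R ^+ C * root_max r b C)) ^+ n / 2 / s.
Proof.
move=> s0 r0 b0 pq0 eE; rewrite uvsum_nil// -RintegralZl//; last exact: integrable_onem_uvmon.
set K := _ ^+ n.
have -> : K / 2 / s = \int[mu]_(x in `[0, 1]) (K / s * x ^+ 1).
  rewrite RintegralZl//; last exact: integrable_Xn.
  by rewrite Rintegral_Xn mulrAC.
apply: le_Rintegral => //.
- by apply: integrable_scale => //; exact: integrable_onem_uvmon.
- by apply: integrable_scale => //; exact: integrable_Xn.
move=> x /=; rewrite in_itv/= => x01; have /andP[x0 x1] := x01.
have sx : 0 < s + x by rewrite ltr_wpDr.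
set w := (s + x)^-1.
have w0 : 0 <= w by rewrite invr_ge0 ltW.
have xw : 0 <= x * w by rewrite mulr_ge0.
have sw : 0 <= s * w by rewrite mulr_ge0// ltW.
have xsw : x * w + s * w = 1 by rewrite -mulrDl addrC divff// gt_eqF.
(* By [s u = x v], [q n] of the factors [u] become [v], raising the power of [x] to [b n + k]. The
   one spare [u] gives [x^k u <= x / s]. *)
have -> : s ^+ (q * n) * ((1 - x ^+ r) ^+ (C * n) * uvmon s e ((p + q) * n).+1 0 x) =
   ((x * w) ^+ p * (s * w) ^+ q) ^+ n * (x ^+ b * (1 - x ^+ r) ^+ C) ^+ n * (x ^+ k * (x * w)).
  rewrite /uvmon -/w expr0 mul1r addn0.
  have -> : (e + ((p + q) * n).+1 = p * n + (b * n + k) + 1)%N by rewrite -eE; lia.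
  have -> : (((p + q) * n).+1 = p * n + q * n + 1)%N by lia.
  by rewrite !exprMn !exprD -!exprM !expr1; ring.
have a0 : 0 <= (x * w) ^+ p * (s * w) ^+ q by rewrite mulr_ge0 ?exprn_ge0.
have xr : 0 <= 1 - x ^+ r by rewrite subr_ge0 exprn_ile1.
have b0' : 0 <= x ^+ b * (1 - x ^+ r) ^+ C by rewrite mulr_ge0 ?exprn_ge0.
have K0 : 0 <= amgm_max p q * (r%:R ^+ C * root_max r b C) :> R.
  by rewrite /amgm_max /root_max !mulr_ge0 ?invr_ge0 ?powR_ge0 ?exprn_ge0.
rewrite -exprMn expr1 -mulrA ler_pM ?exprn_ge0 ?mulr_ge0 ?exprn_ge0//.
  apply: lerXn2r; rewrite ?nnegrE ?mulr_ge0 ?exprn_ge0//.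
  apply: ler_pM => //.
    by rewrite /amgm_max ler_pdivlMr ?exprn_gt0 ?ltr0n// exp_amgm.
  exact: root_amgm.
rewrite (le_trans (ler_piMl _ _))// ?exprn_ile1//.
by rewrite mulrC ler_wpM2r// lef_pV2 ?posrE// lerDl.
Qed.

End integral_bound.

(** * Factorials and products of binomials *)

Section blocks.

(* [cs] lists [c_(m-1), ..., c_1]. Consecutive blocks of factors are separated by one
   missing value, because of the summand [j] in the upper binomial arguments. *)
Fixpoint blocks (n D : nat) (cs : seq nat) : seq nat :=
  if cs is c :: cs' then iota D.+1 (c * n) ++ blocks n (D + c * n).+1 cs' else [::].

Lemma size_blocks n D cs : size (blocks n D cs) = (sumn cs * n)%N.
Proof.
by elim: cs D => //= c cs ih D; rewrite size_cat size_iota ih mulnDl.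
Qed.

Lemma path_ltn_weaken (x y : nat) (s : seq nat) : (x <= y)%N -> path ltn y s -> path ltn x s.
Proof. by case: s => //= z s xy /andP[yz ->]; rewrite (leq_ltn_trans xy). Qed.

Lemma path_blocks n D cs : path ltn D (blocks n D cs).
Proof.
elim: cs D => //= c cs ih D; rewrite cat_path; apply/andP; split.
  by elim: (c * n)%N D => //= k ihk D; rewrite ltnSn ihk.
apply: path_ltn_weaken (ih _).
by elim: (c * n)%N D => //= [|k ihk] D; rewrite ?addn0// -addSnnS.
Qed.

Lemma fact_prod_iota (B c : nat) :
  (B`! * \prod_(h <- iota 0 c) (B.+1 + h) = (B + c)`!)%N.
Proof.
elim: c => [|c ih]; first by rewrite big_nil muln1 addn0.
by rewrite -{1}[c.+1]addn1 iotaD big_cat big_seq1 mulnA ih add0n addnS factS mulnC addSn.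
Qed.

(** The values [l + d] run upwards from [E + 2], skipping [E + 1] and one value between consecutive
    blocks. Each skipped value is at least the matching [n + h + i], so filling the gaps with these
    stays below the full factorial. *)
Lemma blocks_prod_le n l E D h cs : (l + D = E.+1)%N -> (n + h <= E.+1)%N ->
  (E`! * (\prod_(d <- blocks n D cs) (l + d)) * \prod_(i < size cs) (n + h + i) <=
   (E + sumn cs * n + size cs)`!)%N.
Proof.
elim: cs E D h => [|c cs ih] E D h lD nh /=.
  by rewrite big_nil big_ord0 !muln1 mul0n !addn0.
rewrite big_cat/= big_ord_recl addn0.
have E1 : (\prod_(d <- iota D.+1 (c * n)) (l + d) = \prod_(h <- iota 0 (c * n)) (E.+2 + h))%N.
  rewrite -[D.+1]addn0 iotaDl big_map; apply: eq_bigr => i _; lia.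
have := ih (E.+1 + c * n)%N (D + c * n).+1 h.+1; rewrite -fact_prod_iota -E1 factS.
set P1 := (\prod_(d <- iota _ _) _)%N; set P2 := (\prod_(d <- blocks _ _ _) _)%N.
have -> : (\prod_(i < size cs) (n + h.+1 + i) = \prod_(i < size cs) (n + h + lift ord0 i))%N.
  by apply: eq_bigr => i _; rewrite /= /bump; lia.
set Q := (\prod_(i < size cs) _)%N => H.
have -> : (E + (c + sumn cs) * n + (size cs).+1 = E.+1 + c * n + sumn cs * n + size cs)%N by lia.
apply: leq_trans (H _ _); [|lia|lia].
have -> : (E`! * (P1 * P2) * ((n + h) * Q) = (n + h) * (E`! * P1 * P2 * Q))%N by lia.
have -> : (E.+1 * E`! * P1 * P2 * Q = E.+1 * (E`! * P1 * P2 * Q))%N by lia.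
by rewrite leq_mul2r nh orbT.
Qed.

(** After the gaps are filled, the excess of the factorial over [(C n)!] consists of [C n + 1 + i],
    each at most [C (n + 1 + i)]. *)
Lemma blocks_fact_le n c cs : (0 < n)%N -> (0 < c)%N ->
  ((c * n)`! * (\prod_(d <- blocks n 0 cs) ((c * n).+1 + d)) <=
   ((sumn cs + c) * n)`! * (sumn cs + c) ^ size cs)%N.
Proof.
move=> n0 c0; set C := (sumn cs + c)%N.
have C0 : (0 < C)%N by rewrite addn_gt0 c0 orbT.
have P0 : (0 < \prod_(i < size cs) (n + 1 + i))%N by apply: prodn_gt0 => i; lia.
rewrite -(leq_pmul2r P0).
apply: leq_trans (blocks_prod_le _ _ _) _; [lia|nia|].
have -> : (c * n + sumn cs * n = C * n)%N by rewrite -mulnDl addnC.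
rewrite -fact_prod_iota -mulnA leq_mul2l; apply/orP; right.
rewrite -[X in iota 0 X]subn0 -/(index_iota 0 _) big_mkord.
rewrite -[X in (_ <= C ^ X * _)%N]card_ord -prod_nat_const -big_split/=.
by apply: leq_prod => i _; nia.
Qed.

End blocks.

Section binomial_products.
Context {R : realType}.

(** The factorials clear the denominators of the binomials, so that the product splits into linear
    factors in [y]. *)
Definition binprod (a n y : nat) (s : seq nat) : nat :=
  (\prod_(j < size s) ('C(y + (a + \sum_(i < j.+1) nth 0 s i) * n + j.+1, nth 0 s j * n) *
     (nth 0 s j * n)`!))%N.

Lemma bin_fact_prod (B c : nat) : ('C(B + c, c) * c`! = \prod_(h <- iota 0 c) (B.+1 + h))%N.
Proof.
apply/eqP; rewrite -(eqn_pmul2l (fact_gt0 B)) fact_prod_iota; apply/eqP.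
have := bin_fact (leq_addl B c); rewrite addnK => <-; lia.
Qed.

Lemma sum_nth_sumn (s : seq nat) : (\sum_(i < size s) nth 0 s i = sumn s)%N.
Proof. by rewrite sumnE (big_nth 0%N) big_mkord. Qed.

Lemma binprod_rcons a n y s c :
  (binprod a n y (rcons s c) = binprod a n y s *
   \prod_(h <- iota 0 (c * n)) (y + (a + sumn s) * n + size s + 2 + h))%N.
Proof.
rewrite /binprod size_rcons big_ord_recr/=; congr (_ * _)%N.
  apply: eq_bigr => j _; rewrite nth_rcons ltn_ord.
  congr ('C(_ + (_ + _) * _ + _, _) * _)%N; apply: eq_bigr => i _.
  by rewrite nth_rcons (leq_trans (ltn_ord i))// ltn_ord.
have -> : (\sum_(i < (size s).+1) nth 0 (rcons s c) i = sumn s + c)%N.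
  by rewrite -sumn_rcons -sum_nth_sumn size_rcons.
rewrite nth_rcons ltnn eqxx.
have -> : (y + (a + (sumn s + c)) * n + (size s).+1 =
  (y + (a + sumn s) * n + size s).+1 + c * n)%N by lia.
rewrite bin_fact_prod; apply: eq_bigr => h _; lia.
Qed.

(** The factors are listed downwards from the largest one, hence the reversed list; the offset [D]
    lets the induction peel off the last binomial. *)
Lemma binprod_blocks a n r k D cs :
  (binprod a n (r * k) (rev cs))%:R =
  linprod r%:R [seq ((a + sumn cs) * n + size cs + D).+1%:R - d%:R | d <- blocks n D cs] k :> R.
Proof.
elim: cs D => [|c cs ih] D.
  by rewrite /binprod /linprod big_ord0 big_nil.
rewrite rev_cons binprod_rcons natrM (ih (D + c * n).+1) size_rev sumn_rev.
rewrite /= map_cat /linprod big_cat/= mulrC; congr (_ * _).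
  rewrite natr_prod big_map -[D.+1]addn0 iotaDl big_map.
  rewrite -[X in iota 0 X]subn0 -/(index_iota 0 _) !big_mkord.
  rewrite (reindex_inj rev_ord_inj)/=; apply: eq_bigr => i _.
  have H : (i < c * n)%N by [].
  rewrite -natrM -natrB; last nia.
  rewrite -natrD; congr (_%:R); nia.
congr (\prod_(_ <- _) _).
have -> : ((a + sumn cs) * n + size cs + (D + c * n).+1 =
  (a + (c + sumn cs)) * n + (size cs).+1 + D)%N by lia.
by [].
Qed.

Lemma binprod_linprod a n r k s c :
  let e := ((a + sumn s) * n + size s)%N in
  (binprod a n (r * k) (rcons s c))%:R =
  linprod r%:R ([seq (e.+2 + h)%:R | h <- iota 0 (c * n)] ++
    [seq e.+1%:R - d%:R | d <- blocks n 0 (rev s)]) k :> R.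
Proof.
move=> e; rewrite binprod_rcons natrM -{1}(revK s) (binprod_blocks _ _ _ _ 0).
rewrite size_rev sumn_rev addn0 -/e /linprod big_cat/= mulrC; congr (_ * _).
rewrite natr_prod big_map; apply: eq_bigr => h _.
by rewrite -natrM -natrD; congr (_%:R); rewrite /e; lia.
Qed.

End binomial_products.

(** * The error estimate with constant one half *)

Section error_bound.
Context {R : realType}.

Lemma binprod_error_le (s : seq nat) (cm C r b a n : nat) :
  C = (sumn s + cm)%N -> (0 < cm)%N -> (0 < r)%N -> (0 < b)%N -> (0 < n)%N ->
  (a + sumn s <= b <= a + sumn s + cm)%N ->
  `|((C * n)`!%:R * (- r%:R) ^+ (C * n))^-1 *
     altsum (C * n) (fun k => (binprod a n (r * k) (rcons s cm))%:R *
       (euler_gamma R - euler_S R (r * k + (b * n + (size s).+1))))| <=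
  (C ^ size s)%:R / 2 * (amgm_max (C + a - b) (cm + b - a - C) * root_max r b C) ^+ n.
Proof.
move=> CE cm0 r0 b0 n0 /andP[ab ba].
set p := (C + a - b)%N; set q := (cm + b - a - C)%N.
(* The bounds on [b] keep the subtractions in [p] and [q] from truncating. *)
have cmE : cm = (p + q)%N by rewrite /p /q CE; lia.
pose e := ((a + sumn s) * n + size s)%N.
have eq : (e + q * n = b * n + size s)%N.
  have -> : q = (b - (a + sumn s))%N by rewrite /q CE; lia.
  by rewrite /e addnAC -mulnDl subnKC.
pose ds := blocks n 0 (rev s).
have NE : (C * n = cm * n + size ds)%N by rewrite size_blocks sumn_rev CE; lia.
have qc : (q * n <= cm * n)%N by rewrite leq_mul2r cmE leq_addl orbT.
set X := amgm_max p q * root_max r b C.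
have X0 : 0 <= X by rewrite /X /amgm_max /root_max !mulr_ge0 ?invr_ge0 ?powR_ge0 ?exprn_ge0.
have rR : 0 < r%:R :> R by rewrite ltr0n.
have main := @euler_comb_le R (C * n).+1
  (fun k => (-1) ^+ k * 'C(C * n, k)%:R * (binprod a n (r * k) (rcons s cm))%:R)
  (fun k => r * k + (b * n + (size s).+1))%N
  ((C * n)`!%:R * (C ^ size s)%:R * (r%:R ^+ C * X) ^+ n / 2).
have -> : altsum (C * n) (fun k => (binprod a n (r * k) (rcons s cm))%:R *
       (euler_gamma R - euler_S R (r * k + (b * n + (size s).+1)))) =
  \sum_(k < (C * n).+1) (-1) ^+ k * 'C(C * n, k)%:R * (binprod a n (r * k) (rcons s cm))%:R *
       (euler_gamma R - euler_S R (r * k + (b * n + (size s).+1))).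
  by apply: eq_bigr => k _; rewrite mulrA.
rewrite normrM normfV normrM normrX normrN !(ger0_norm (ler0n _ _)).
rewrite ler_pdivrMl; last by rewrite mulr_gt0 ?exprn_gt0// ltr0n fact_gt0.
apply: le_trans (main _) _; last first.
  by rewrite exprMn exprM le_eqVlt; apply/orP; left; apply/eqP; ring.
move=> t t0.
have -> : \sum_(k < (C * n).+1) (-1) ^+ k * 'C(C * n, k)%:R *
       (binprod a n (r * k) (rcons s cm))%:R *
       cmom t (r * k + (b * n + (size s).+1)) =
   altsum (C * n) (fun k => linprod r%:R ([seq (e.+2 + h)%:R | h <- iota 0 (cm * n)] ++
    [seq e.+1%:R - d%:R | d <- ds]) k * cmom t (r * k + (e.+1 + q * n))).
  apply: eq_bigr => k _; rewrite -mulrA; congr (_ * (_ * _)).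
    exact: binprod_linprod.
  by congr (cmom _ (_ + _)); rewrite addSn eq addnS.
apply: le_trans (@cauchy_moment_sum_le R t r _ t0 _ _ e ds qc NE (path_blocks _ _ _)) _.
have U := @uvsum_nil_le R t r b C p q n e (size s) t0 r0 b0 _ eq.
have XE : amgm_max p q * (r%:R ^+ C * root_max r b C) = r%:R ^+ C * X by rewrite /X; ring.
rewrite -cmE XE in U; set Z := (_ * X) ^+ n in U *.
have Z0 : 0 <= Z by rewrite exprn_ge0// mulr_ge0// exprn_ge0// ltW.
apply: le_trans (ler_wpM2l _ (U cm0)) _.
  by rewrite mulr_ge0// prodr_ge0.
have F := blocks_fact_le (rev s) n0 cm0.
rewrite size_rev sumn_rev -CE -/ds in F.
have {}F : (cm * n)`!%:R * \prod_(d <- ds) ((cm * n).+1 + d)%:R <=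
   (C * n)`!%:R * (C ^ size s)%:R :> R.
  by rewrite -natr_prod -!natrM ler_nat.
by rewrite !mulrA ler_wpM2r ?invr_ge0 ?(ltW t0)// ler_wpM2r// ler_wpM2r.
Qed.

End error_bound.

Unset Implicit Arguments.

Theorem theorem5 (R : realType) (m : nat) (c : m.-tuple nat)
    (hm : (0 < m)%N) (hc : forall i : 'I_m, (0 < tnth c i)%N) :
  let C := (\sum_(i < m) tnth c i)%N in
  let cm := last 0%N c in
  exists M : R, M < (C ^ (m - 1))%:R /\
  forall r b a : nat, (0 < r)%N -> (0 < b)%N ->
  a%:Z - cm%:Z <= b%:Z - C%:Z <= a%:Z ->
  forall n : nat, (0 < n)%N ->
  `| euler_gamma R
     - (\prod_(j < m) (tnth c j * n)`!%:R)
         / ((C * n)`!%:R * (- r%:R) ^+ (C * n))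
       * \sum_(0 <= k < (C * n).+1)
           (-1) ^+ k * 'C(C * n, k)%:R
           * (\prod_(j < m)
                'C(r * k + (a + \sum_(i < m | (i <= j)%N) tnth c i) * n + j.+1,
                   tnth c j * n)%:R)
           * euler_S R (r * k + b * n + m) |
  < M * ( (b%:R `^ (b%:R / r%:R)) * C%:R ^+ C
          * (C + a - b)%:R ^+ (C + a - b)
          * (cm + b - a - C)%:R ^+ (cm + b - a - C)
          / (cm%:R ^+ cm * (b + C * r)%:R `^ (C%:R + b%:R / r%:R)) ) ^+ n.
Proof.
move=> C cm.
have sz : size c = m by exact: size_tuple.
have [s csE] : exists s, tval c = rcons s cm.
  rewrite /cm; case/lastP: (tval c) sz => [m0|s x _]; first by rewrite -m0 in hm.
  by exists s; rewrite last_rcons.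
have mE : m = (size s).+1 by rewrite -sz csE size_rcons.
have CE : C = (sumn s + cm)%N.
  rewrite -sumn_rcons -csE -sum_nth_sumn sz; apply: eq_bigr => i _.
  by rewrite (tnth_nth 0%N).
have cm0 : (0 < cm)%N.
  have H : (m.-1 < m)%N by rewrite prednK.
  have := hc (Ordinal H); rewrite (tnth_nth 0%N) /= csE mE /= nth_rcons ltnn eqxx.
  by [].
have C0 : (0 < C)%N by rewrite CE addn_gt0 cm0 orbT.
have M0 : 0 < (C ^ (m - 1))%:R :> R by rewrite ltr0n expn_gt0 C0.
(* The estimate holds with the factor 1/2; a factor strictly between 1/2 and 1 makes both
   inequalities strict. *)
exists (2 / 3 * (C ^ (m - 1))%:R); split; first by lra.
move=> r b a r0 b0 /andP[h1 h2] n n0.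
have ab : (a + sumn s <= b <= a + sumn s + cm)%N by rewrite CE in h1 h2; lia.
have := @binprod_error_le R s cm C r b a n CE cm0 r0 b0 n0 ab => H.
set p := (C + a - b)%N in H *; set q := (cm + b - a - C)%N in H *.
have cmE : cm = (p + q)%N by rewrite /p /q CE; lia.
have -> : b%:R `^ (b%:R / r%:R) * C%:R ^+ C * p%:R ^+ p * q%:R ^+ q /
    (cm%:R ^+ cm * (b + C * r)%:R `^ (C%:R + b%:R / r%:R)) =
    amgm_max p q * root_max r b C :> R.
  by rewrite /amgm_max /root_max -cmE invfM; ring.
set Y := amgm_max p q * root_max r b C in H *.
(* With [0^0 = 1], positivity persists when [p] or [q] is 0, as strictness requires. *)
have xx (k : nat) : 0 < k%:R ^+ k :> R by case: k => [|k]; rewrite ?expr0// exprn_gt0.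
have Y0 : 0 < Y.
  rewrite /Y /amgm_max /root_max !mulr_gt0 ?invr_gt0 ?powR_gt0 ?ltr0n//.
  by rewrite ltn_addr.
apply: (@le_lt_trans _ _ ((C ^ (m - 1))%:R / 2 * Y ^+ n)); last first.
  by rewrite ltr_pM2r ?exprn_gt0//; lra.
have -> : (m - 1 = size s)%N by rewrite mE subn1.
apply: le_trans H; rewrite le_eqVlt; apply/orP; left; apply/eqP; congr `|_|.
set N := (C * n)%N; set P := fun k => (binprod a n (r * k) (rcons s cm))%:R : R.
have rR : (- r%:R) ^+ N != 0 :> R by rewrite expf_neq0// oppr_eq0 pnatr_eq0 -lt0n.
have NF : N`!%:R != 0 :> R by rewrite pnatr_eq0 -lt0n fact_gt0.
(* There are exactly [N] linear factors, so the weights of the sum, once normalised, add up to 1 and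
   [gamma] can be moved inside. *)
have normal : altsum N P = (- r%:R) ^+ N * N`!%:R.
  rewrite (altsum_ext _ (fun k => binprod_linprod a n r k s cm)).
  have sN : size ([seq (((a + sumn s) * n + size s).+2 + h)%:R : R | h <- iota 0 (cm * n)] ++
      [seq ((a + sumn s) * n + size s).+1%:R - d%:R | d <- blocks n 0 (rev s)]) = N.
    by rewrite size_cat !size_map size_iota size_blocks sumn_rev /N CE; lia.
  by rewrite altsum_linprod sN ?leqnn// eqxx.
have PE k : (\prod_(j < m) (tnth c j * n)`!%:R) *
    (\prod_(j < m) 'C(r * k + (a + \sum_(i < m | (i <= j)%N) tnth c i) * n + j.+1,
                   tnth c j * n)%:R) = P k.
  rewrite -big_split /P /binprod -csE sz natr_prod /=; apply: eq_bigr => j _.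
  rewrite natrM mulrC !(tnth_nth 0%N); congr ('C(_ + (_ + _) * _ + _, _)%:R * _).
  under eq_bigr do rewrite (tnth_nth 0%N).
  rewrite -(big_mkord (fun i => i <= j)%N (fun i => nth 0%N c i)).
  rewrite -(big_mkord xpredT (fun i => nth 0%N c i)).
  by rewrite [RHS](big_nat_widen 0%N _ m).
rewrite big_mkord -mulrA.
have gE : euler_gamma R = (N`!%:R * (- r%:R) ^+ N)^-1 * altsum N (fun k => euler_gamma R * P k).
  by rewrite altsumZ normal mulrCA [_ ^+ N * _]mulrC mulVf ?mulr1// mulf_neq0.
rewrite {1}gE [X in _ - X]mulrCA -mulrBr; congr (_ * _).
rewrite mulr_sumr -sumrB; apply: eq_bigr => k _.
rewrite [(binprod _ _ _ _)%:R](_ : _ = P k)// -PE.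
have -> : (r * k + b * n + m = r * k + (b * n + (size s).+1))%N by rewrite mE addnA.
ring.
Qed.
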